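(* Let $\mathscr S$ be an operator system, let $\mathscr T$ be a unital $C^*$-algebra, and let $\mathcal K,\mathcal L\subseteq\mathrm{CP}(\mathscr S,\mathscr T)$. Then the following are equivalent: (i) $\overline{\mathrm{cconv}(\mathcal K)}^{\,\tau}\subseteq\overline{\mathrm{cconv}(\mathcal L)}^{\,\tau}$. (ii) For every matrix test $(k,f,s)$, $h_{\mathcal K}(k,f,s)\le h_{\mathcal L}(k,f,s)$.
   Context: Unital $C^*$-algebras are assumed nonzero ($\mathbb 1\neq 0$). $\mathrm{CP}(\mathscr S,\mathscr T)$ is the set of all completely positive linear maps $\mathscr S\to\mathscr T$. For a linear map $\Phi:\mathscr S\to\mathscr T$ and $k\in\mathbb N$ ($k\ge1$), $\Phi_k:M_k(\mathscr S)\to M_k(\mathscr T)$ is the ampliation $\Phi_k([s_{ij}])=[\Phi(s_{ij})]$. A $C^*$-convex combination of $\Phi_1,\dots,\Phi_n\in \mathrm{CP}(\mathscr S,\mathscr T)$ is a map $\sum_{i=1}^n a_i^*\Phi_i(\cdot)a_i$ with $a_i\in\mathscr T$ and $\sum_{i=1}^n a_i^*a_i=\mathbb 1_{\mathscr T}$ ($n\ge 1$). A subset of $\mathrm{CP}(\mathscr S,\mathscr T)$ is $C^*$-convex if it is closed under all such finite combinations of its elements; $\mathrm{cconv}(\mathcal K)$ is the smallest $C^*$-convex subset of $\mathrm{CP}(\mathscr S,\mathscr T)$ containing $\mathcal K$ (so $\mathrm{cconv}(\varnothing)=\varnothing$). A matrix test is a triple $(k,f,s)$ with $k\in\mathbb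 N$, $f$ a state on $M_k(\mathscr T)$ (positive linear functional with $f(\mathbb 1)=1$), and $s\in M_k(\mathscr S)$. $\mathcal E=\mathrm{span}_{\mathbb C}(\mathrm{CP}(\mathscr S,\mathscr T))$, a complex vector space of linear maps $\mathscr S\to\mathscr T$. $\tau$ is the locally convex topology on $\mathcal E$ generated by the seminorms $p_{k,f,s}(\Phi)=|f(\Phi_k(s))|$ over all matrix tests $(k,f,s)$, and $\overline{\,\cdot\,}^{\,\tau}$ is $\tau$-closure in $\mathcal E$. The support function of $\mathcal K\subseteq\mathrm{CP}(\mathscr S,\mathscr T)$ is $h_{\mathcal K}(k,f,s)=\sup_{\Psi\in\mathrm{cconv}(\mathcal K)}\Re f(\Psi_k(s))\in[-\infty,\infty]$, with $\sup\varnothing=-\infty$. *)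

(* Defs.v *)
From HB Require Import structures.
From mathcomp Require Import all_boot all_order all_algebra.
From mathcomp Require Import all_classical all_reals all_analysis.
From mathcomp Require Import complex.

Set Implicit Arguments.
Unset Strict Implicit.
Unset Printing Implicit Defensive.

Import Order.TTheory GRing.Theory Num.Theory.
Import numFieldNormedType.Exports.

Local Open Scope classical_set_scope.
Local Open Scope ring_scope.
Local Open Scope complex_scope.

(* Unital complex C*-algebras, with a real-valued norm.  The axiom [1 != 0] is
   part of [GRing.Algebra].  The norm is a field of the mixin because the
   hierarchy admits no join of its normed modules with its algebras: their only
   common descendants are the ordered domains. *)
HB.mixin Record isCstarAlgebra (R : realType) A of GRing.Algebra R[i] A := {
  star : A -> A;
  cstar_norm : A -> R;
  starD : forall x y : A, star (x + y) = star x + star y;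
  starZ : forall (c : R[i]) (x : A), star (c *: x) = c^*%C *: star x;
  starM : forall x y : A, star (x * y) = star y * star x;
  starK : involutive star;
  cstar_normD : forall x y : A,
    cstar_norm (x + y) <= cstar_norm x + cstar_norm y;
  cstar_normZ : forall (c : R[i]) (x : A),
    cstar_norm (c *: x) = Normc.normc c * cstar_norm x;
  cstar_norm0_eq0 : forall x : A, cstar_norm x = 0 -> x = 0;
  cstar_normM : forall x y : A,
    cstar_norm (x * y) <= cstar_norm x * cstar_norm y;
  cstar_norm_starM : forall x : A, cstar_norm (star x * x) = cstar_norm x ^+ 2;
  cstar_complete : forall u : nat -> A,
    (forall e : R, 0 < e -> exists N : nat, forall m n : nat,
      (N <= m)%N -> (N <= n)%N -> cstar_norm (u m - u n) < e) ->
    exists l : A, forall e : R, 0 < e -> exists N : nat, forall n : nat,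
      (N <= n)%N -> cstar_norm (u n - l) < e
}.

#[short(type="cstarAlgType")]
HB.structure Definition CstarAlgebra (R : realType) :=
  {A of isCstarAlgebra R A & GRing.Algebra R[i] A}.

Section Matrices.
Variables (R : realType) (A : cstarAlgType R).

(* Matrices over [A] have no module structure over [R[i]] in the library. *)
Definition mxscale m n (c : R[i]) (X : 'M[A]_(m, n)) : 'M[A]_(m, n) :=
  map_mx (fun x => c *: x) X.

Definition mxstar m n (X : 'M[A]_(m, n)) : 'M[A]_(n, m) := map_mx star X^T.

(* The positive elements of the C*-algebra [M_k(A)]. *)
Definition mxpositive k (X : 'M[A]_k) : Prop :=
  exists Y : 'M[A]_k, X = mxstar Y *m Y.

(* The order on [R[i]] makes [0 <= z] mean that [z] is real and nonnegative. *)
Record mxstate (k : nat) := MxState {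
  mxstate_fun :> 'M[A]_k -> R[i];
  mxstate_linear : forall (c : R[i]) (X Y : 'M[A]_k),
    mxstate_fun (mxscale c X + Y) = c * mxstate_fun X + mxstate_fun Y;
  mxstate_ge0 : forall X : 'M[A]_k, mxpositive X -> 0 <= mxstate_fun X;
  mxstate1 : mxstate_fun 1%:M = 1
}.

End Matrices.

(* Operator systems are taken concretely: unital self-adjoint linear subspaces
   of a unital C*-algebra. *)
Record opSystem (R : realType) (A : cstarAlgType R) := OpSystem {
  opsys_set : set A;
  opsys_has1 : opsys_set 1;
  opsys_linear : forall (c : R[i]) x y,
    opsys_set x -> opsys_set y -> opsys_set (c *: x + y);
  opsys_star : forall x, opsys_set x -> opsys_set (star x)
}.

Section OpSystemType.
Variables (R : realType) (A : cstarAlgType R) (S : opSystem A).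

Definition opsys_pred : {pred A} := [pred x | `[< opsys_set S x >]].

Lemma opsys_submod_closed : submod_closed opsys_pred.
Proof.
have S0 : opsys_set S 0.
  by rewrite -(addNr 1) -scaleN1r; apply: opsys_linear; exact: opsys_has1.
split; first exact/asboolP.
by move=> c x y /asboolP Sx /asboolP Sy; apply/asboolP; exact: opsys_linear.
Qed.

HB.instance Definition _ :=
  GRing.isSubmodClosed.Build _ _ opsys_pred opsys_submod_closed.

Record opsys_sort :=
  OpsysSort { opsys_val :> A; opsys_valP : opsys_val \in opsys_pred }.

HB.instance Definition _ := [isSub for opsys_val].
HB.instance Definition _ := [Choice of opsys_sort by <:].
HB.instance Definition _ := [SubChoice_isSubLmodule of opsys_sort by <:].

(* The cone of [M_k(S)] is the one inherited from [M_k(A)]. *)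
Definition opsys_mxpositive k (s : 'M[opsys_sort]_k) : Prop :=
  mxpositive (map_mx opsys_val s).

End OpSystemType.

Coercion opsys_sort : opSystem >-> Sortclass.

Section CompletelyPositive.
Variables (R : realType) (A T : cstarAlgType R) (S : opSystem A).

Definition CP : set (S -> T) :=
  [set Phi | linear Phi /\
    forall k (s : 'M[S]_k.+1),
      opsys_mxpositive s -> mxpositive (map_mx Phi s)].

Definition cstar_convex (M : set (S -> T)) : Prop :=
  forall n (Phi : 'I_n.+1 -> S -> T) (a : 'I_n.+1 -> T),
    (forall i, M (Phi i)) ->
    \sum_i star (a i) * a i = 1 ->
    M (fun x => \sum_i star (a i) * Phi i x * a i).

Definition cconv (K : set (S -> T)) : set (S -> T) :=
  smallest (fun M => M `<=` CP /\ cstar_convex M) K.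

(* A matrix test of size [k = mt_dim.+1]. *)
Record matrix_test := MatrixTest {
  mt_dim : nat;
  mt_state : mxstate T mt_dim.+1;
  mt_elt : 'M[S]_mt_dim.+1
}.

Definition test_eval (t : matrix_test) (Phi : S -> T) : R[i] :=
  mt_state t (map_mx Phi (mt_elt t)).

Definition support_fun (K : set (S -> T)) (t : matrix_test) : \bar R :=
  ereal_sup [set (complex.Re (test_eval t Psi))%:E | Psi in cconv K].

Definition CP_span : {pred (S -> T)} :=
  [pred Phi | `[< exists n (c : 'I_n -> R[i]) (F : 'I_n -> S -> T),
    (forall i, CP (F i)) /\ Phi = \sum_i c i *: F i >]].

Lemma CP_span_submod_closed : submod_closed CP_span.
Proof.
split=> [|b f g /asboolP[m [c [F [FC ->]]]] /asboolP[n [d [G [GC ->]]]]];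
  apply/asboolP.
  exists 0%N, (fun=> 0), (fun=> 0).
  by split; [case | rewrite big_ord0].
exists (m + n)%N, (fun i => match fintype.split i with inl j => b * c j | inr j => d j end),
  (fun i => match fintype.split i with inl j => F j | inr j => G j end).
split; first by move=> i; case: (fintype.split i).
rewrite big_split_ord /= scaler_sumr; congr (_ + _); apply: eq_bigr => i _.
  by rewrite (unsplitK (inl i)) scalerA.
by rewrite (unsplitK (inr i)).
Qed.

HB.instance Definition _ :=
  GRing.isSubmodClosed.Build _ _ CP_span CP_span_submod_closed.

(* The span of the completely positive maps, which carries [tau] below. *)
Record Espace := ESpace { E_val :> S -> T; E_valP : E_val \in CP_span }.

HB.instance Definition _ := [isSub for E_val].
HB.instance Definition _ := [Choice of Espace by <:].
HB.instance Definition _ := [SubChoice_isSubLmodule of Espace by <:].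

Definition test_seminorm (t : matrix_test) (Phi : Espace) : R :=
  Normc.normc (test_eval t Phi).

Definition tau_ball n (t : 'I_n -> matrix_test) (e : R) (Phi : Espace) :
    set Espace :=
  [set Psi | forall i, test_seminorm (t i) (Psi - Phi) < e].

(* [tau]: the finite intersections of seminorm balls around [Phi] form a
   neighbourhood base at [Phi]. *)
Definition tau_nbhs (Phi : Espace) : set_system Espace :=
  [set U | exists n (t : 'I_n -> matrix_test) (e : R),
    0 < e /\ tau_ball t e Phi `<=` U].

HB.instance Definition _ := hasNbhs.Build Espace tau_nbhs.

Lemma test_seminorm0 t : test_seminorm t 0 = 0.
Proof.
have test0 : test_eval t (E_val 0) = 0.
  rewrite /test_eval.
  have -> : map_mx (E_val 0) (mt_elt t) = mxscale (-1) 1%:M + 1%:M.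
    by apply/matrixP => i j; rewrite !mxE scaleN1r addNr.
  by rewrite mxstate_linear mulN1r addNr.
by rewrite /test_seminorm test0 Normc.normc0.
Qed.

Lemma test_seminormD t Phi Psi :
  test_seminorm t (Phi + Psi) <= test_seminorm t Phi + test_seminorm t Psi.
Proof.
rewrite /test_seminorm.
have -> : test_eval t (E_val (Phi + Psi)) = test_eval t Phi + test_eval t Psi.
  rewrite /test_eval -[mt_state t (map_mx Phi _)]mul1r -mxstate_linear; congr (mt_state t _).
  by apply/matrixP => i j; rewrite !mxE scale1r.
exact: le_normcD.
Qed.

Lemma tau_nbhs_filter (Phi : Espace) : ProperFilter (tau_nbhs Phi).
Proof.
split.
  move=> [n [t [e [e0 sub]]]]; apply: (sub Phi) => i.
  by rewrite subrr test_seminorm0.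
split.
- by exists 0%N, (fun i : 'I_0 => match notF (ltn_ord i) with end), 1; split.
- move=> U V [m [t [e [e0 tU]]]] [n [u [d [d0 uV]]]].
  exists (m + n)%N, (fun i => match fintype.split i with inl j => t j | inr j => u j end),
    (Num.min e d).
  split=> [|Psi B]; first by rewrite lt_min e0.
  split.
    apply: tU => i; move: (B (lshift n i)).
    by rewrite (unsplitK (inl i)) lt_min => /andP[].
  apply: uV => i; move: (B (rshift m i)).
  by rewrite (unsplitK (inr i)) lt_min => /andP[].
- move=> U V UV [n [t [e [e0 tU]]]].
  by exists n, t, e; split => //; exact: subset_trans UV.
Qed.

Lemma tau_nbhs_singleton (Phi : Espace) (U : set Espace) :
  tau_nbhs Phi U -> U Phi.
Proof.
move=> [n [t [e [e0 tU]]]]; apply: tU => i.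
by rewrite subrr test_seminorm0.
Qed.

Lemma tau_nbhs_nbhs (Phi : Espace) (U : set Espace) :
  tau_nbhs Phi U -> tau_nbhs Phi (tau_nbhs^~ U).
Proof.
move=> [n [t [e [e0 tU]]]]; exists n, t, (e / 2); split; first exact: divr_gt0.
move=> Psi B; exists n, t, (e / 2); split; first exact: divr_gt0.
move=> Xi B'; apply: tU => i.
rewrite -(subrKA Psi) (splitr e); apply: le_lt_trans (test_seminormD _ _ _) _.
exact: ltrD.
Qed.

HB.instance Definition _ := Nbhs_isNbhsTopological.Build Espace
  tau_nbhs_filter tau_nbhs_singleton tau_nbhs_nbhs.

Definition tau_closure (M : set (S -> T)) : set Espace :=
  closure [set Phi : Espace | M Phi].

End CompletelyPositive.

Arguments CP {R A} T S.

(* Main.v *)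
(** If a map [Phi] in the closure of [cconv K] had a basic neighbourhood missing
    [cconv L], then finitely many test values of [Phi] would be at positive
    distance from the convex set of the corresponding values on [cconv L].
    Separating in a finite-dimensional real space gives a linear combination of
    tests, and a block-diagonal matrix test with the mean of the block states
    realises this combination, contradicting the inequality of support functions.

    Two facts about C*-algebras are needed. There must be at least one test, that
    is, one state, to treat the case where [cconv L] is empty; and [CP] must be
    C*-convex, so that [cconv K] lies in it, which requires sums of positive
    matrices over [T] to be of the form [Y^* Y]. Both follow from the positivity
    of [y^* y], the second one after making [M_k(T)] a C*-algebra. The order is
    handled through [specsup a = inf_{t >= 0} (|t + a| - t)], which is sublinear
    on the whole algebra. *)

Require Import Defs.
From HB Require Import structures.
From mathcomp Require Import all_boot all_order all_algebra.
From mathcomp Require Import all_classical all_reals all_analysis.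
From mathcomp Require Import complex ring lra.
From Stdlib Require Ncring Ncring_tac.

Set Implicit Arguments.
Unset Strict Implicit.
Unset Printing Implicit Defensive.

Import Order.TTheory GRing.Theory Num.Theory.

Local Open Scope classical_set_scope.
Local Open Scope ring_scope.
Local Open Scope complex_scope.

(** * Normalisation of identities in noncommutative rings *)

Section NoncommutativeRing.
Variable T : nzRingType.

#[export] Instance nc_ring_ops : @Ncring.Ring_ops T 0 1 (@GRing.add T)
  (@GRing.mul T) (fun x y => x - y) (@GRing.opp T) (@eq T) := {}.

#[export] Instance nc_ring : @Ncring.Ring T 0 1 (@GRing.add T)
  (@GRing.mul T) (fun x y => x - y) (@GRing.opp T) (@eq T) nc_ring_ops.
Proof.
split; rewrite /= ?/Morphisms.Proper ?/Morphisms.respectful.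
- by split; [move=> ? | move=> ? ? -> | move=> ? ? ? -> ->].
- by move=> ? ? -> ? ? ->.
- by move=> ? ? -> ? ? ->.
- by move=> ? ? -> ? ? ->.
- by move=> ? ? ->.
- exact: add0r.
- exact: addrC.
- exact: addrA.
- exact: mul1r.
- exact: mulr1.
- exact: mulrA.
- by move=> x y z; exact: mulrDl.
- by move=> x y z; exact: mulrDr.
- by [].
- exact: subrr.
Qed.

End NoncommutativeRing.

Ltac ncring := Ncring_tac.non_commutative_ring.

(** * The norm, the functional [specsup] and the cone it defines *)

Section CstarNorm.
Variables (R : realType) (A : cstarAlgType R).
Implicit Types (x y : A) (r t : R).

Local Notation N := (@cstar_norm R A).

(** Real scalars as central elements of [A]: identities that mix scalars and products become ring
    identities, within reach of [ncring]. *)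
Definition sc r : A := r%:C *: 1.

Lemma normc_real r : Normc.normc r%:C = `|r|.
Proof. by rewrite /Normc.normc /= expr0n /= addr0 sqrtr_sqr. Qed.

Lemma normcN1 : Normc.normc (-1 : R[i]) = 1.
Proof. by rewrite /Normc.normc /= oppr0 expr0n addr0 sqrrN expr1n sqrtr1. Qed.

Lemma scE r x : sc r * x = r%:C *: x.
Proof. by rewrite /sc -scalerAl mul1r. Qed.

Lemma scC r x : x * sc r = sc r * x.
Proof. by rewrite scE /sc -scalerAr mulr1. Qed.

Lemma scCA r x y : x * (sc r * y) = sc r * (x * y).
Proof. by rewrite mulrA scC mulrA. Qed.

Lemma comm_sc r x : GRing.comm x (sc r).
Proof. exact: scC. Qed.

Lemma scD r t : sc (r + t) = sc r + sc t.
Proof. by rewrite /sc rmorphD scalerDl. Qed.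

Lemma scN r : sc (- r) = - sc r.
Proof. by rewrite /sc rmorphN scaleNr. Qed.

Lemma scB r t : sc (r - t) = sc r - sc t.
Proof. by rewrite scD scN. Qed.

Lemma scM r t : sc (r * t) = sc r * sc t.
Proof. by rewrite scE /sc rmorphM scalerA. Qed.

Lemma sc0 : sc 0 = 0.
Proof. by rewrite /sc rmorph0 scale0r. Qed.

Lemma sc1 : sc 1 = 1.
Proof. by rewrite /sc rmorph1 scale1r. Qed.

Lemma scK r x : r != 0 -> sc r * (sc r^-1 * x) = x.
Proof. by move=> r0; rewrite mulrA -scM mulfV // sc1 mul1r. Qed.

Lemma scVK r x : r != 0 -> sc r^-1 * (sc r * x) = x.
Proof. by move=> r0; rewrite mulrA -scM mulVf // sc1 mul1r. Qed.

Lemma star0 : star 0 = 0 :> A.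
Proof. by apply: (addrI (star 0)); rewrite -starD !addr0. Qed.

Lemma starN x : star (- x) = - star x.
Proof. by apply/eqP; rewrite -subr_eq0 opprK -starD addNr star0. Qed.

Lemma starB x y : star (x - y) = star x - star y.
Proof. by rewrite starD starN. Qed.

Lemma star1 : star 1 = 1 :> A.
Proof.
have h : star (star 1 * 1) = 1 :> A by rewrite mulr1 starK.
by rewrite starM starK mulr1 in h.
Qed.

Lemma star_sc r : star (sc r) = sc r.
Proof. by rewrite starZ star1 conjc_real. Qed.

Lemma starX x n : star (x ^+ n) = star x ^+ n.
Proof.
by elim: n => [|n IH]; rewrite ?expr0 ?star1 // exprS starM IH -exprSr.
Qed.

Lemma star_sum (I : Type) (s : seq I) (P : pred I) (F : I -> A) :
  star (\sum_(i <- s | P i) F i) = \sum_(i <- s | P i) star (F i).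
Proof. by apply: (big_morph _ starD star0). Qed.

Lemma cnorm0 : N 0 = 0.
Proof. by rewrite -(scale0r (0 : A)) cstar_normZ Normc.normc0 mul0r. Qed.

Lemma cnormN x : N (- x) = N x.
Proof.
by rewrite -scaleN1r cstar_normZ normcN1 mul1r.
Qed.

Lemma cnormBC x y : N (x - y) = N (y - x).
Proof. by rewrite -cnormN opprB. Qed.

Lemma cnorm_ge0 x : 0 <= N x.
Proof.
have := cstar_normD x (- x); rewrite subrr cnorm0 cnormN.
by rewrite -mulr2n pmulrn_lge0.
Qed.

Lemma cnorm1 : N 1 = 1.
Proof.
have := cstar_norm_starM (1 : A); rewrite star1 mulr1 expr2.
have [/cstar_norm0_eq0/eqP|N0] := eqVneq (N 1) 0; first by rewrite oner_eq0.
by move=> /(congr1 ( *%R^~ (N 1)^-1)); rewrite mulfK // mulfV.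
Qed.

Lemma cnormsc r x : N (sc r * x) = `|r| * N x.
Proof. by rewrite scE cstar_normZ normc_real. Qed.

Lemma cnorm_sc r : N (sc r) = `|r|.
Proof. by rewrite -[sc r]mulr1 cnormsc cnorm1 mulr1. Qed.

Lemma cnorm_star x : N (star x) = N x.
Proof.
have le y : N y <= N (star y).
  have := cstar_normM (star y) y; rewrite cstar_norm_starM expr2.
  have [->|y0] := eqVneq (N y) 0; first by rewrite cnorm_ge0.
  by rewrite ler_pM2r // lt_neqAle eq_sym y0 cnorm_ge0.
by apply/eqP; rewrite eq_le -{2}[x]starK !le.
Qed.

Lemma cnorm_sqr x : star x = x -> N (x * x) = N x ^+ 2.
Proof. by move=> xs; rewrite -cstar_norm_starM xs. Qed.

(** Iterating the C*-identity gives exact norms along dyadic powers. This replaces the spectral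
    radius formula. *)
Lemma cnorm_exp2 x k : star x = x -> N (x ^+ (2 ^ k)) = N x ^+ (2 ^ k).
Proof.
move=> xs; elim: k => [|k IH]; first by rewrite !expr1.
by rewrite expnSr !exprM expr2 cnorm_sqr ?IH // starX xs.
Qed.

Lemma cnormB x y : N x - N y <= N (x - y).
Proof. by rewrite lerBlDr -{1}(subrK y x) cstar_normD. Qed.

(* For self-adjoint [a], this is the largest point of its spectrum. *)
Definition specsup (a : A) : R :=
  inf [set N (sc t + a) - t | t in [set t : R | 0 <= t]].

Lemma specsup_has_inf a :
  has_inf [set N (sc t + a) - t | t in [set t : R | 0 <= t]].
Proof.
split; first by exists (N (sc 0 + a) - 0), 0 => //=.
exists (- N a) => _ [t /= t0 <-]; rewrite lerBrDr addrC.
by have := cnormB (sc t) (- a); rewrite cnorm_sc ger0_norm // cnormN opprK.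
Qed.

Lemma specsup_le a t : 0 <= t -> specsup a <= N (sc t + a) - t.
Proof.
by move=> t0; apply: ge_inf; [exact: (specsup_has_inf a).2 | exists t].
Qed.

(** By the triangle inequality [|t + a| - t] does not increase with [t], so a bound reached at one
    [t0] persists beyond it: the infimum is a limit at infinity. *)
Lemma specsup_lt a e : specsup a < e ->
  exists2 t0, 0 <= t0 & forall t, t0 <= t -> N (sc t + a) < t + e.
Proof.
move=> ae; have [] := @inf_adherent R _ (e - specsup a) _ (specsup_has_inf a).
  by rewrite subr_gt0.
move=> _ [t0 /= t0_ge0 <-]; rewrite -/(specsup a) subrKC => te.
exists t0 => // t tt0; rewrite -(subrK t0 t) scD -addrA addrC.
apply: le_lt_trans (cstar_normD _ _) _.
rewrite cnorm_sc ger0_norm ?subr_ge0 //; lra.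
Qed.

Lemma specsupD a b : specsup (a + b) <= specsup a + specsup b.
Proof.
apply/ler_addgt0Pr => e e0.
have h2 : 0 < e / 2 by rewrite divr_gt0.
have [|t t0 ta] := @specsup_lt a (specsup a + e / 2); first by rewrite ltrDl.
have [|s s0 sb] := @specsup_lt b (specsup b + e / 2); first by rewrite ltrDl.
have ts0 : 0 <= t + s by rewrite addr_ge0.
apply: le_trans (specsup_le _ ts0) _.
have -> : sc (t + s) + (a + b) = (sc t + a) + (sc s + b) by rewrite scD addrACA.
have := ta _ (lexx _); have := sb _ (lexx _).
have := cstar_normD (sc t + a) (sc s + b); lra.
Qed.

Lemma specsup_norm a : specsup a <= N a.
Proof. by have := specsup_le a (lexx 0); rewrite sc0 add0r subr0. Qed.

Lemma specsup_sc r : specsup (sc r) <= r.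
Proof.
have r0 : 0 <= `|r| by [].
apply: le_trans (specsup_le _ r0) _.
have h : 0 <= `|r| + r by have := ler_norm (- r); rewrite normrN; lra.
by rewrite -scD cnorm_sc ger0_norm //; lra.
Qed.

Lemma specsup0 : specsup 0 = 0.
Proof.
apply/eqP; rewrite eq_le -{1}sc0 specsup_sc /=.
by have := specsupD 0 0; rewrite addr0; lra.
Qed.

Lemma specsup_ge0D a : 0 <= specsup a + specsup (- a).
Proof. by rewrite -specsup0 -(subrr a) specsupD. Qed.

Lemma specsup_scD r a : specsup (sc r + a) = r + specsup a.
Proof.
apply/eqP; rewrite eq_le.
rewrite (le_trans (specsupD _ _)) ?lerD2r ?specsup_sc //=.
have := specsupD (sc (- r)) (sc r + a); rewrite addrA -scD addNr sc0 add0r.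
have := specsup_sc (- r); lra.
Qed.

Lemma specsupZ_le r a : 0 < r -> specsup (sc r * a) <= r * specsup a.
Proof.
move=> r0; rewrite -ler_pdivrMl //; apply: lb_le_inf.
  exact: (specsup_has_inf a).1.
move=> _ [t /= t0 <-]; rewrite ler_pdivrMl //.
have rt0 : 0 <= r * t by rewrite mulr_ge0 // ltW.
apply: le_trans (specsup_le _ rt0) _.
by rewrite scM -mulrDr cnormsc gtr0_norm // mulrBr.
Qed.

Lemma specsupZ r a : 0 <= r -> specsup (sc r * a) = r * specsup a.
Proof.
rewrite le0r => /orP[/eqP->|r0]; first by rewrite sc0 !mul0r specsup0.
apply/eqP; rewrite eq_le specsupZ_le //= -ler_pdivlMl //.
by rewrite -{1}(scVK a (lt0r_neq0 r0)) specsupZ_le // invr_gt0.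
Qed.

Lemma specsup_mono a b : specsup (b - a) <= 0 -> specsup b <= specsup a.
Proof. by move=> ba; have := specsupD (b - a) a; rewrite subrK; lra. Qed.

(** With this form, closure under sums is immediate from sublinearity. Self-adjointness is not
    included and is carried separately. *)
Definition pos a := specsup (- a) <= 0.

Lemma posD a b : pos a -> pos b -> pos (a + b).
Proof. by rewrite /pos opprD => a0 b0; have := specsupD (- a) (- b); lra. Qed.

Lemma pos0 : pos 0.
Proof. by rewrite /pos oppr0 specsup0. Qed.

Lemma posZ r a : 0 <= r -> pos a -> pos (sc r * a).
Proof.
by move=> r0 a0; rewrite /pos -mulrN specsupZ // mulr_ge0_le0.
Qed.

Lemma pos_sum (I : Type) (s : seq I) (P : pred I) (F : I -> A) :
  (forall i, P i -> pos (F i)) -> pos (\sum_(i <- s | P i) F i).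
Proof.
move=> F0.
by apply: (big_ind (fun a => pos a)) => //; [exact: pos0 | exact: posD].
Qed.

Lemma pos_specsup a r : pos (sc r - a) -> specsup a <= r.
Proof. by rewrite /pos opprB addrC -scN specsup_scD; lra. Qed.

Lemma specsup_pos a r : specsup a <= r -> pos (sc r - a).
Proof. by rewrite /pos opprB addrC -scN specsup_scD; lra. Qed.

End CstarNorm.

(** * Self-adjoint elements and square roots *)

Section SelfAdjoint.
Variables (R : realType) (A : cstarAlgType R).
Implicit Types (x y a b : A) (r t : R).

Local Notation N := (@cstar_norm R A).
Local Notation sc := (@sc R A).

Definition ii : A := 'i%C *: 1.

Lemma iiC x : x * ii = ii * x.
Proof. by rewrite /ii -scalerAr -scalerAl mulr1 mul1r. Qed.

Lemma ii_sqr : ii * ii = -1.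
Proof. by rewrite /ii -scalerAl mul1r scalerA -expr2 sqr_i scaleN1r. Qed.

Lemma star_ii : star ii = - ii.
Proof.
rewrite starZ star1 -scaleNr; congr (_ *: _).
by apply/eqP; rewrite eq_complex /= oppr0 !eqxx.
Qed.

Lemma iiM_sqr x : (ii * x) * (ii * x) = - (x * x).
Proof. by rewrite -mulrA (mulrA x) iiC !mulrA ii_sqr !mulN1r mulNr. Qed.

(** The element [v = a + i b] satisfies [v^* v = a^2 + b^2], and its real part [a] has norm at most
    [|v|]. *)
Lemma sqr_cnorm_le a b : star a = a -> star b = b -> GRing.comm a b ->
  N a ^+ 2 <= N (a * a + b * b).
Proof.
move=> as_ bs ab; pose v := a + ii * b.
have vs : star v = a - ii * b by rewrite starD starM as_ bs star_ii mulrN iiC.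
have -> : a * a + b * b = star v * v.
  have e : a * (ii * b) = ii * b * a by rewrite mulrA iiC -!mulrA ab.
  rewrite vs /v; transitivity (a * a - (ii * b) * (ii * b) + (a * (ii * b) - ii * b * a)).
    by rewrite iiM_sqr e opprK subrr addr0.
  by ncring.
rewrite cstar_norm_starM lerXn2r ?nnegrE ?cnorm_ge0 //.
have e : sc 2 * a = v + star v.
  by rewrite vs /v -[2%:R]/(1 + 1) scD sc1; ncring.
have := cstar_normD v (star v); rewrite -e cnormsc cnorm_star gtr0_norm //; lra.
Qed.

(* With [w = s a] and [h = w^2 / 2], the element [1 - h + i w] has squared norm
   [|1 + h^2|], so [|1 - h| <= 1 + O(s^4)]; then [s] tends to [0]. *)
Lemma pos_square a : star a = a -> pos (a * a).
Proof.
move=> as_.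
have key t : 0 < t -> specsup (- (a * a)) <= N (a * a) ^+ 2 / (2 * t).
  move=> t0; pose s := Num.sqrt (2 / t); pose w := sc s * a.
  pose h := sc t^-1 * (a * a).
  have ss : s * s = 2 / t.
    by rewrite -expr2 sqr_sqrtr // divr_ge0 // ltW.
  have ww : w * w = h + h.
    rewrite /w /h -mulrA scCA mulrA -scM ss mulrA -mulrDl -scD.
    by rewrite -mulrA; congr (sc _ * _); field; rewrite lt0r_neq0.
  have ws : star w = w by rewrite starM star_sc as_ scC.
  have hs : star h = h by rewrite !starM star_sc as_ scC.
  have wh : GRing.comm w h.
    have : GRing.comm w (w * w) by rewrite /GRing.comm mulrA.
    rewrite ww /GRing.comm mulrDr mulrDl => e.
    have : sc 2 * (w * h) = sc 2 * (h * w).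
      by rewrite -[2%:R]/(1 + 1) scD sc1 !mulrDl !mul1r.
    by move=> /(congr1 ( *%R (sc 2^-1))); rewrite -!(mulrA (sc _)) ?scVK.
  have := @sqr_cnorm_le (1 - h) w.
  rewrite starB star1 hs => /(_ erefl ws) => /(_ _)/wrap[].
    by apply: commr_sym; apply: commrB => //; exact: commr1.
  have -> : (1 - h) * (1 - h) + w * w = 1 + h * h by rewrite ww; ncring.
  move=> h1.
  have h2 : N (1 - h) ^+ 2 <= 1 + N h ^+ 2.
    rewrite (le_trans h1) // (le_trans (cstar_normD _ _)) //.
    by rewrite cnorm1 lerD2l cnorm_sqr.
  have h3 : N (1 - h) <= 1 + N h ^+ 2 / 2.
    rewrite leNgt; apply/negP => lt.
    have := cnorm_ge0 h => Nh0; have : 0 <= N h ^+ 2 by rewrite exprn_ge0.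
    nra.
  have -> : - (a * a) = sc t * (- h).
    by rewrite mulrN /h scK // lt0r_neq0.
  rewrite specsupZ ?(ltW t0) // -ler_pdivlMl //.
  apply: le_trans (specsup_le _ ler01) _; rewrite sc1.
  rewrite lerBlDl (le_trans h3) // lerD2l /h cnormsc gtr0_norm ?invr_gt0 //.
  rewrite le_eqVlt; apply/orP; left; apply/eqP; field; exact: lt0r_neq0.
rewrite /pos leNgt; apply/negP => s0; set s := specsup _ in key s0.
(* For this [t] the bound of [key] is at most [s / 2], against [s > 0]; the summand 1 keeps [t]
   positive. *)
have := key ((N (a * a) ^+ 2 + 1) / s).
have N0 : 0 <= N (a * a) ^+ 2 by rewrite exprn_ge0 // cnorm_ge0.
have P0 : 0 < N (a * a) ^+ 2 + 1 by lra.
move=> /(_ (divr_gt0 P0 s0)).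
have -> : N (a * a) ^+ 2 / (2 * ((N (a * a) ^+ 2 + 1) / s)) =
   s * (N (a * a) ^+ 2 / (N (a * a) ^+ 2 + 1)) / 2.
  by field; rewrite !lt0r_neq0.
have : N (a * a) ^+ 2 / (N (a * a) ^+ 2 + 1) <= 1 by rewrite ler_pdivrMr //; lra.
nra.
Qed.

(** Identities between limits are proved below through this criterion, with [e] the distance from an
    iterate to the limit. *)
Lemma cnorm_small x C : 0 <= C -> (forall e, 0 < e -> N x <= C * e) -> x = 0.
Proof.
move=> C0 h; apply: cstar_norm0_eq0; apply/eqP; rewrite eq_le cnorm_ge0 andbT.
rewrite leNgt; apply/negP => x0.
have C1 : 0 < 2 * (C + 1) by lra.
have := h (N x / (2 * (C + 1))) (divr_gt0 x0 C1).
have -> : C * (N x / (2 * (C + 1))) = N x * (C / (2 * (C + 1))) by field; lra.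
have : C / (2 * (C + 1)) <= 2^-1 by rewrite ler_pdivrMr //; lra.
nra.
Qed.

(* [k = 1 - w], where [w] is the limit of [w_{n+1} = (h + w_n^2) / 2]; the
   increments are dominated by those of the scalar iteration for [h = 1]. *)
Lemma sqrt_1B h : star h = h -> N h <= 1 ->
  exists k, [/\ star k = k, k * k = 1 - h &
    forall x, GRing.comm x h -> GRing.comm x k].
Proof.
move=> hs h1.
pose w n := iter n (fun v => sc 2^-1 * (h + v * v)) 0.
pose om n : R := iter n (fun v => 2^-1 * (1 + v ^+ 2)) 0.
have wS n : w n.+1 = sc 2^-1 * (h + w n * w n) by [].
have omS n : om n.+1 = 2^-1 * (1 + om n ^+ 2) by [].
have ws n : star (w n) = w n.
  by elim: n => [|n IH]; rewrite ?star0 // wS starM star_sc starD hs starM IH scC.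
have wC n x : GRing.comm x h -> GRing.comm x (w n).
  move=> xh; elim: n => [|n IH]; first exact: commr0.
  by rewrite wS; apply: commrM; [exact: comm_sc | apply: commrD => //; exact: commrM].
have om0 n : 0 <= om n.
  by elim: n => // n IH; rewrite omS; have := sqr_ge0 (om n); lra.
have om1 n : om n <= 1.
  by elim: n => [|n IH]; rewrite ?ler01 // omS; have := om0 n; nra.
have wom n : N (w n) <= om n.
  elim: n => [|n IH]; first by rewrite cnorm0.
  rewrite wS omS cnormsc gtr0_norm ?invr_gt0 // ler_pM2l ?invr_gt0 //.
  rewrite (le_trans (cstar_normD _ _)) // lerD // cnorm_sqr //.
  by rewrite lerXn2r // nnegrE ?cnorm_ge0.
have wd n : N (w n.+1 - w n) <= om n.+1 - om n.
  elim: n => [|n IH].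
    rewrite wS omS /= mulr0 !addr0 !subr0 expr0n /= addr0 mulr1.
    by rewrite cnormsc gtr0_norm ?invr_gt0 // ler_piMr.
  rewrite (wS n.+1) {1}(wS n) (omS n.+1) {1}(omS n).
  have -> : sc 2^-1 * (h + w n.+1 * w n.+1) - sc 2^-1 * (h + w n * w n) =
     sc 2^-1 * (w n.+1 * (w n.+1 - w n) + (w n.+1 - w n) * w n) by ncring.
  have -> : 2^-1 * (1 + om n.+1 ^+ 2) - 2^-1 * (1 + om n ^+ 2) =
     2^-1 * (om n.+1 * (om n.+1 - om n) + (om n.+1 - om n) * om n) by ring.
  rewrite cnormsc gtr0_norm ?invr_gt0 // ler_pM2l ?invr_gt0 //.
  rewrite (le_trans (cstar_normD _ _)) // lerD // (le_trans (cstar_normM _ _)) //;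
    by rewrite ler_pM // cnorm_ge0.
have wdD n m : N (w (n + m)%N - w n) <= om (n + m)%N - om n.
  elim: m => [|m IH]; first by rewrite addn0 !subrr cnorm0.
  rewrite addnS; have := wd (n + m)%N.
  have := cstar_normD (w (n + m).+1 - w (n + m)%N) (w (n + m)%N - w n).
  by rewrite subrKA; lra.
have omnd n m : om n <= om (n + m)%N.
  by rewrite -subr_ge0 (le_trans _ (wdD n m)) // cnorm_ge0.
have omsup : has_sup (range om).
  split; first by exists (om 0%N), 0%N.
  by exists 1 => _ [n _ <-].
have [l hl] : exists l : A, forall e : R, 0 < e -> exists M : nat, forall n : nat,
      (M <= n)%N -> N (w n - l) < e.
  apply: cstar_complete => e e0.
  (* The scalar sequence [om] is monotone and bounded, and it dominates the increments of [w], so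
     closeness of [om M] to its supremum controls the whole tail of [w]. *)
  have [_ [M _ <-] hM] := sup_adherent e0 omsup.
  have near m n : (M <= m)%N -> (m <= n)%N -> N (w n - w m) < e.
    move=> Mm mn; have := wdD m (n - m)%N; rewrite subnKC // => wmn.
    have : om n <= sup (range om) by apply: sup_upper_bound => //; exists n.
    have := omnd M (m - M)%N; rewrite subnKC //; lra.
  exists M => m n Mm Mn; have [mn|/ltnW nm] := leqP m n.
    by rewrite cnormBC near.
  by rewrite near.
have lE : h + l * l - sc 2 * l = 0.
  apply: (@cnorm_small _ (N l + 1 + 2)) => [|e e0].
    by have := cnorm_ge0 l; lra.
  have [M hM] := hl _ e0; have := hM _ (leqnSn M); have := hM _ (leqnn M).
  (* The first bracket vanishes by the recursion; the remaining terms are small because [w M] and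
     [w M.+1] are both close to [l]. *)
  have -> : h + l * l - sc 2 * l =
    (h + w M * w M - sc 2 * w M.+1) + (sc 2 * (w M.+1 - l) -
      ((w M - l) * w M + l * (w M - l))) by ncring.
  rewrite {1}wS scK // subrr add0r => lt1 lt2.
  have := cnormN ((w M - l) * w M + l * (w M - l)).
  have := cstar_normD (sc 2 * (w M.+1 - l)) (- ((w M - l) * w M + l * (w M - l))).
  have := cstar_normD ((w M - l) * w M) (l * (w M - l)).
  have := cstar_normM (w M - l) (w M); have := cstar_normM l (w M - l).
  rewrite cnormsc gtr0_norm //.
  have := le_trans (wom M) (om1 M); have := cnorm_ge0 (w M - l).
  have := cnorm_ge0 l; have := cnorm_ge0 (w M); nra.
exists (1 - l); split.
- rewrite starB star1; congr (_ - _); apply/eqP; rewrite -subr_eq0; apply/eqP.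
  apply: (@cnorm_small _ 2) => // e e0; have [M hM] := hl _ e0.
  have := hM _ (leqnn M); have := cstar_normD (star (l - w M)) (w M - l).
  rewrite cnorm_star (cnormBC l) starB ws subrKA; lra.
- have -> : (1 - l) * (1 - l) = 1 - h + (h + l * l - sc 2 * l).
    by rewrite -[2%:R]/(1 + 1) scD sc1; ncring.
  by rewrite lE addr0.
- move=> x xh; apply: commrB; first exact: commr1.
  apply/eqP; rewrite -subr_eq0; apply/eqP.
  apply: (@cnorm_small _ (2 * N x)) => [|e e0].
    by have := cnorm_ge0 x; lra.
  have [M hM] := hl _ e0; have := hM _ (leqnn M).
  have -> : x * l - l * x = (w M - l) * x - x * (w M - l) + (x * w M - w M * x).
    by ncring.
  rewrite (wC M x xh) subrr addr0.
  have := cstar_normD ((w M - l) * x) (- (x * (w M - l))); rewrite cnormN.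
  have := cstar_normM (w M - l) x; have := cstar_normM x (w M - l).
  have := cnorm_ge0 x; have := cnorm_ge0 (w M - l); nra.
Qed.

(** Write [a = t (1 - h)] with [h = 1 - a / t], which has norm at most 1, and scale the root of
    [1 - h] by the root of [t]. *)
Lemma sqrt_inner a t : star a = a -> 0 < t -> N (sc t - a) <= t ->
  exists k, [/\ star k = k, k * k = a &
    forall x, GRing.comm x a -> GRing.comm x k].
Proof.
move=> as_ t0 ta; pose h := 1 - sc t^-1 * a.
have t1 : t != 0 by rewrite lt0r_neq0.
have hE : h = sc t^-1 * (sc t - a) by rewrite mulrBr -scM mulVf // sc1.
have [||k [ks kk kC]] := @sqrt_1B h.
- by rewrite starB star1 starM star_sc as_ scC.
- by rewrite hE cnormsc gtr0_norm ?invr_gt0 // ler_pdivrMl // mulr1.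
exists (sc (Num.sqrt t) * k); split.
- by rewrite starM star_sc ks scC.
- rewrite -mulrA scCA kk /h opprB addrCA subrr addr0 !mulrA -!scM.
  by rewrite -expr2 sqr_sqrtr 1?ltW // mulfV // sc1 mul1r.
- move=> x xa; apply: commrM; first exact: comm_sc.
  by apply/kC/commrB; [exact: commr1 | apply: commrM => //; exact: comm_sc].
Qed.

(* [q = sqrt ((r + d)^2 - a^2)] makes [a + i q] have norm [r + d]. *)
Lemma cnorm_le_specsup a r : star a = a -> specsup a <= r ->
  specsup (- a) <= r -> N a <= r.
Proof.
move=> as_ ar aNr; apply/ler_addgt0Pr => d d0.
have root b : star b = b -> specsup (- b) <= r ->
    exists k, [/\ star k = k, k * k = sc (r + d) + b &
    forall x, GRing.comm x b -> GRing.comm x k].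
  (* The margin [d] makes the spectral bound strict, and [specsup_lt] turns it into the norm
     estimate that [sqrt_inner] asks for. Passing to [t + 1] ensures a positive scalar. *)
  move=> bs br; have [|t t0 ht] := @specsup_lt _ _ (- (sc (r + d) + b)) 0.
    by rewrite opprD -scN specsup_scD; lra.
  have t1 : 0 < t + 1 by lra.
  have [|||k [ks kk kC]] := @sqrt_inner (sc (r + d) + b) (t + 1) => //.
  - by rewrite starD star_sc bs.
  - by have := ht (t + 1); rewrite addr0 => /(_ _)/wrap[]; [lra | exact: ltW].
  exists k; split => // x xb; apply: kC; apply: commrD => //; exact: comm_sc.
have [|//|k1 [k1s k1k k1C]] := root (- a); first by rewrite starN as_.
  by rewrite opprK.
have [//|//|k2 [k2s k2k k2C]] := root a.
have a1 : GRing.comm a k1 by apply: k1C; exact: commrN.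
have a2 : GRing.comm a k2 by exact: k2C.
have k12 : GRing.comm k1 k2 by apply: k2C; exact: commr_sym.
(* The root [q] is the product of the commuting roots [k1] of [r + d - a] and [k2] of
   [r + d + a]. *)
have := @sqr_cnorm_le a (k1 * k2) as_.
rewrite starM k1s k2s -k12 => /(_ erefl (commrM a1 a2)).
have -> : a * a + k1 * k2 * (k1 * k2) = sc ((r + d) * (r + d)).
  have -> : k1 * k2 * (k1 * k2) = (k1 * k1) * (k2 * k2).
    by rewrite -!mulrA; congr (_ * _); rewrite !mulrA -k12.
  by rewrite k1k k2k scM mulrDl !mulrDr mulNr scC; ncring.
have := specsup_ge0D a => s0.
have rd : 0 <= r + d by lra.
rewrite cnorm_sc -expr2 ger0_norm ?sqr_ge0 //.
by rewrite ler_pXn2r // ?nnegrE ?cnorm_ge0.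
Qed.

(** With [t] half the norm of [a], both [t - a] and [a - t] have [specsup] at most [t], hence
    [|t - a| <= t] and [sqrt_inner] applies. The zero element is separate because [t] must be
    positive. *)
Lemma pos_sqrt a : star a = a -> pos a ->
  exists k, [/\ star k = k, k * k = a &
    forall x, GRing.comm x a -> GRing.comm x k].
Proof.
move=> as_ a0; have [Na|Na] := eqVneq (N a) 0.
  exists 0; rewrite star0 mul0r (cstar_norm0_eq0 _ Na); by split.
have t0 : 0 < N a / 2 by rewrite divr_gt0 // lt_def Na cnorm_ge0.
apply: (sqrt_inner as_ t0); apply: cnorm_le_specsup.
- by rewrite starB star_sc as_.
- by rewrite specsup_scD; rewrite /pos in a0; lra.
- rewrite opprB addrC -scN specsup_scD; have := specsup_norm a; lra.
Qed.

End SelfAdjoint.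

(** * Positivity of [y^* y] *)

(** A linear factor cannot make up for exponential growth: if [x = s (1 + d)] with [d > 0], squaring
    Bernoulli's inequality gives a quadratic lower bound. The exponents are dyadic to match
    [cnorm_exp2]. *)
Lemma pow2_growth (R : realType) (x s C : R) : 0 <= C -> 0 < s ->
  (forall k, x ^+ (2 ^ k) <= s ^+ (2 ^ k) * (1 + (2 ^ k)%:R * C)) -> x <= s.
Proof.
move=> C0 s0 h; rewrite leNgt; apply/negP => xs.
pose d := x / s - 1.
have d0 : 0 < d by rewrite subr_gt0 ltr_pdivlMr // mul1r.
have xE : x = s * (1 + d) by rewrite /d subrKC mulrC divfK // lt0r_neq0.
have bern n : 1 + n%:R * d <= (1 + d) ^+ n.
  elim: n => [|n IH]; first by rewrite mul0r addr0.
  rewrite exprS; have : 0 <= n%:R :> R by [].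
  rewrite -natr1; have := ltW d0; nra.
(* Then [j = 2^k] satisfies [2 C < j d^2], so [(1 + j d)^2] exceeds [1 + 2 j C], the bound that the
   hypothesis gives at [k + 1]. *)
pose k := Num.bound (2 * C / d ^+ 2).
have d2 : 0 < d ^+ 2 by rewrite exprn_gt0.
have kb : 2 * C / d ^+ 2 < (2 ^ k)%:R.
  have : 0 <= 2 * C / d ^+ 2 by apply: divr_ge0; [lra | exact: ltW].
  move=> /archi_boundP lt; apply: lt_le_trans lt _; rewrite ler_nat ltnW //.
  exact: ltn_expl.
have := h k.+1; rewrite xE exprMn ler_pM2l ?exprn_gt0 // expnSr exprM.
have := bern (2 ^ k)%N; rewrite natrM.
move: kb; rewrite ltr_pdivrMr //; set j : R := (2 ^ k)%:R => jb.
have j0 : 0 < j by rewrite ltr0n expn_gt0.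
set e := (1 + d) ^+ _ => e1 e2.
have : (1 + j * d) ^+ 2 <= e ^+ 2.
  by rewrite lerXn2r // nnegrE; have := mulr_ge0 (ltW j0) (ltW d0); lra.
move: jb e2; rewrite !expr2 => jb e2.
have : j * (2 * C) < j * (j * (d * d)) by rewrite ltr_pM2l.
have := mulr_gt0 j0 d0; nra.
Qed.

Section Positive.
Variables (R : realType) (A : cstarAlgType R).
Implicit Types (x y z a b : A) (r t m : R).

Local Notation N := (@cstar_norm R A).
Local Notation sc := (@sc R A).
Local Notation ii := (@ii R A).

(* [z^* z] and [z z^*] have the same nonzero spectrum; this is seen on powers,
   through [(t + z z^* )^n = t^n + z Q_n z^*]. *)
Lemma specsup_starC z m : 0 < m -> specsup (star z * z) < m ->
  specsup (z * star z) <= m.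
Proof.
move=> m0 /specsup_lt[t t0 /(_ _ (lexx t))].
set b := star z * z; set g := z * star z => tb.
pose s := t + m; have s0 : 0 < s by rewrite /s; lra.
suff : N (sc t + g) <= s by move=> le; have := specsup_le g t0; rewrite /s in le; lra.
have gz : (sc t + g) * z = z * (sc t + b) by rewrite mulrDl mulrDr scC /g /b mulrA.
(* The estimate says [|Q| <= n s^(n-1)]; the factor [s] on the left avoids a predecessor in the
   exponent. *)
have pw n : exists2 Q, (sc t + g) ^+ n = sc (t ^+ n) + z * Q * star z &
    s * N Q <= n%:R * s ^+ n.
  elim: n => [|n [Q e le]].
    by exists 0; rewrite ?expr0 ?sc1 ?mulr0 ?mul0r ?addr0 // cnorm0 mulr0.
  exists (sc (t ^+ n) + (sc t + b) * Q).
    have cz : z * sc (t ^+ n) * star z = g * sc (t ^+ n).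
      by rewrite scC -mulrA [RHS]scC.
    rewrite exprS e mulrDr !mulrA gz exprS scM.
    transitivity (sc t * sc (t ^+ n) + z * sc (t ^+ n) * star z +
      z * (sc t + b) * Q * star z); first by rewrite cz; ncring.
    by ncring.
  have := cstar_normD (sc (t ^+ n)) ((sc t + b) * Q).
  have := cstar_normM (sc t + b) Q.
  rewrite cnorm_sc ger0_norm ?exprn_ge0 // exprS.
  have : t ^+ n <= s ^+ n by rewrite lerXn2r // ?nnegrE ?ltW // /s; lra.
  have Q0 := cnorm_ge0 Q; have tb0 := cnorm_ge0 (sc t + b).
  have : N (sc t + b) * N Q <= s * N Q by rewrite ler_wpM2r // /s ltW.
  rewrite -natr1; nra.
apply: (@pow2_growth _ _ _ (N z ^+ 2 / s)) => // [|k].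
  by rewrite divr_ge0 ?exprn_ge0 ?cnorm_ge0 // ltW.
rewrite -cnorm_exp2; last by rewrite starD star_sc /g starM starK.
have [Q -> le] := pw (2 ^ k)%N.
have := cstar_normD (sc (t ^+ (2 ^ k))) (z * Q * star z).
have := cstar_normM (z * Q) (star z); have := cstar_normM z Q.
rewrite cnorm_star cnorm_sc ger0_norm ?exprn_ge0 //.
have : t ^+ (2 ^ k) <= s ^+ (2 ^ k) by rewrite lerXn2r // ?nnegrE ?ltW // /s; lra.
have z0 := cnorm_ge0 z; have Q0 := cnorm_ge0 Q; have zQ0 := cnorm_ge0 (z * Q).
have : N z ^+ 2 * N Q <= s ^+ (2 ^ k) * ((2 ^ k)%:R * (N z ^+ 2 / s)).
  have -> : N z ^+ 2 * N Q = N z ^+ 2 / s * (s * N Q) by field; lra.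
  rewrite [leRHS]mulrC (mulrAC _ (N z ^+ 2 / s)) [leRHS]mulrC ler_wpM2l //.
  by rewrite divr_ge0 ?exprn_ge0 // ltW.
rewrite expr2; nra.
Qed.

(* Let [b = y^* y] and [z = y (1 - b)^(n/2)]. Then [b (1 - b)^n = z^* z] is at most
   [1 / n], hence so is [z z^*]; as [z^* z + z z^*] is a sum of squares,
   [b >= z^* z >= - 1 / n]. *)
Lemma pos_starM_small y : N y <= 1 -> pos (star y * y).
Proof.
move=> y1; have [b bE] : exists b, b = star y * y by exists (star y * y).
rewrite -bE; have bs : star b = b by rewrite bE starM starK.
have b1 : N b <= 1 by rewrite bE cstar_norm_starM expr_le1 // cnorm_ge0.
have [k [ks kk kC]] := sqrt_1B bs b1.
have bk : GRing.comm b k by exact: kC.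
have bkn n : GRing.comm b (k ^+ n) by exact: commrX.
(* This is [(1 - b)^n], written as a square so that [pos_square] gives its positivity. *)
pose u n := k ^+ n * k ^+ n.
have uS n : u n.+1 = u n - b * u n.
  by rewrite /u -!exprD addSn addnS !exprS mulrA kk mulrBl mul1r.
have bu n : GRing.comm b (u n) by apply: commrM.
have posu n : pos (u n) by apply: pos_square; rewrite starX ks.
have posbu n : pos (b * b * u n).
  have -> : b * b * u n = (b * k ^+ n) * (b * k ^+ n).
    by rewrite /u -!mulrA; congr (_ * _); rewrite !mulrA bkn.
  by apply: pos_square; rewrite starM starX bs ks bkn.
have c1 n : pos (b - b * u n).
  elim: n => [|n IH]; first by rewrite /u !expr0 !mulr1 subrr; exact: pos0.
  have -> : b - b * u n.+1 = b - b * u n + b * b * u n by rewrite uS; ncring.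
  exact: posD.
(* The passage from [n] to [n + 1] adds [(n + 1) b^2 u_n], which is positive. Adding [u n] then
   yields [n b u_n <= 1]. *)
have c2 n : pos (1 - u n - sc n%:R * (b * u n)).
  elim: n => [|n IH].
    by rewrite /u !expr0 mulr1 subrr sc0 mul0r subr0; exact: pos0.
  have -> : 1 - u n.+1 - sc n.+1%:R * (b * u n.+1) =
      1 - u n - sc n%:R * (b * u n) + sc n.+1%:R * (b * b * u n).
    by rewrite uS -natr1 scD sc1; ncring.
  by apply: posD => //; exact: posZ.
have key n : n.+1%:R * specsup (- b) <= 2.
  have n0 : 0 < n.+1%:R :> R by rewrite ltr0n.
  have bu1 : n.+1%:R * specsup (b * u n.+1) <= 1.
    rewrite -specsupZ ?(ltW n0) //; apply: pos_specsup; rewrite sc1.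
    have := posD (c2 n.+1) (posu n.+1); congr (pos _); ncring.
  pose z := y * k ^+ n.+1.
  have zz : star z * z = b * u n.+1.
    rewrite /z starM starX ks !mulrA -(mulrA _ (star y)) -bE -bkn -!mulrA.
    by rewrite /u.
  (* The numerator is 2 since [specsup_starC] asks for a strict inequality and only [1 / (n + 1)] as
     a weak bound is known for [z^* z]. *)
  have zz' : specsup (z * star z) <= 2 / n.+1%:R.
    apply: specsup_starC; first by rewrite divr_gt0.
    by rewrite zz ltr_pdivlMr // mulrC; lra.
  have sum : pos (star z * z + z * star z).
    have p1 : pos ((z + star z) * (z + star z)).
      by apply: pos_square; rewrite starD starK addrC.
    have p2 : pos ((ii * (z - star z)) * (ii * (z - star z))).
      apply: pos_square; rewrite starM star_ii starB starK mulrN -mulNr opprB.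
      exact: iiC.
    have h2 : 0 <= 2^-1 :> R by rewrite invr_ge0.
    have := posZ h2 (posD p1 p2).
    rewrite iiM_sqr; congr (pos _).
    have -> : (z + star z) * (z + star z) + - ((z - star z) * (z - star z)) =
      (1 + 1) * (star z * z + z * star z) by ncring.
    by rewrite -sc1 -scD mulrA -scM mulVf // sc1 mul1r.
  have le1 : specsup (- b) <= specsup (- (star z * z)).
    apply: specsup_mono; have := c1 n.+1; rewrite /pos zz; congr (specsup _ <= _).
    by rewrite opprB opprK addrC.
  have le2 : specsup (- (star z * z)) <= specsup (z * star z).
    apply: specsup_mono; move: sum; rewrite /pos; congr (specsup _ <= _).
    by rewrite opprD.
  by rewrite mulrC -ler_pdivlMr //; exact: le_trans le1 (le_trans le2 zz').
rewrite /pos leNgt; apply/negP => s0; set s := specsup _ in key s0.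
have := @archi_boundP R (2 / s); rewrite divr_ge0 ?ltW // => /(_ isT).
set n := Num.bound _; rewrite ltr_pdivrMr // => lt.
by have := key n; rewrite -natr1; lra.
Qed.

Lemma pos_starM y : pos (star y * y).
Proof.
have [y0|y0] := eqVneq (N y) 0.
  by rewrite (cstar_norm0_eq0 _ y0) mulr0; exact: pos0.
have y_gt0 : 0 < N y by rewrite lt_def y0 cnorm_ge0.
have := @pos_starM_small (sc (N y)^-1 * y).
rewrite cnormsc ger0_norm ?invr_ge0 ?cnorm_ge0 // mulVf // lexx => /(_ isT).
have N2 : 0 <= N y * N y by rewrite mulr_ge0 ?ltW.
move=> /(posZ N2); congr (pos _).
rewrite starM star_sc scC -mulrA (scCA _ (star y)) !mulrA -!scM.
by rewrite mulfK // mulfV // sc1 mul1r.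
Qed.

Lemma posP a : star a = a -> pos a <-> exists x, a = star x * x.
Proof.
move=> as_; split=> [/(pos_sqrt as_)[k [ks kk _]]|[x ->]].
  by exists k; rewrite ks.
exact: pos_starM.
Qed.

(** Both summands lie in the cone [pos], which is closed under sums, and a self-adjoint element of
    the cone has a square root. *)
Lemma sum_starM x y : exists z, star x * x + star y * y = star z * z.
Proof.
apply/posP; last by apply: posD; exact: pos_starM.
by rewrite starD !starM !starK.
Qed.

Lemma pos_conj x a : star a = a -> pos a -> pos (star x * a * x).
Proof.
move=> as_ /(posP as_)[y ->].
by rewrite -mulrA -(mulrA _ y) mulrA -starM; exact: pos_starM.
Qed.

End Positive.

(** * Hahn-Banach extension and states *)

Section HahnBanach.
Variables (R : realType) (V : lmodType R).
Implicit Types (p q : V -> R) (x y : V).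

(** One inequality for positive scalars is enough: applied to the inverse scalar it gives the
    equality [sublinearZ]. *)
Definition sublinear q :=
  (forall x y, q (x + y) <= q x + q y) /\
  (forall r x, 0 < r -> q (r *: x) <= r * q x).

Lemma sublinear0 q : sublinear q -> q 0 = 0.
Proof.
move=> [_ qZ]; have := qZ 2 0; have := qZ 2^-1 0.
by rewrite !scaler0 invr_gt0 => /(_ (ltr0Sn _ _)) ? /(_ (ltr0Sn _ _)) ?; lra.
Qed.

Lemma sublinearZ q r x : sublinear q -> 0 <= r -> q (r *: x) = r * q x.
Proof.
move=> ql; rewrite le0r => /orP[/eqP->|r0].
  by rewrite scale0r mul0r sublinear0.
apply/eqP; rewrite eq_le ql.2 //= -ler_pdivlMl //.
by rewrite -{1}(scalerK (lt0r_neq0 r0) x) ql.2 // invr_gt0.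
Qed.

Lemma sublinearN_ge q x : sublinear q -> - q (- x) <= q x.
Proof.
move=> ql; have := ql.1 x (- x).
by rewrite subrr (sublinear0 ql); lra.
Qed.

(* Minimality is applied to [inf_{t >= 0} (q (x + t y) - t q y)], which lies
   below [q] and is again sublinear. *)
Lemma minimal_sublinear_additive q : sublinear q ->
  (forall q', sublinear q' -> (forall x, q' x <= q x) -> q' = q) ->
  forall x y, q (x + y) = q x + q y.
Proof.
move=> ql qmin x y.
pose F z := [set q (z + t *: y) - t * q y | t in [set t : R | 0 <= t]].
have Finf z : has_inf (F z).
  split; first by exists (q (z + 0 *: y) - 0 * q y), 0 => //=.
  exists (- q (- z)) => _ [t /= t0 <-].
  have := ql.1 (z + t *: y) (- z); rewrite addrC addKr.
  by rewrite (sublinearZ _ ql t0); lra.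
have Fle z t : 0 <= t -> inf (F z) <= q (z + t *: y) - t * q y.
  by move=> t0; apply: ge_inf; [exact: (Finf z).2 | exists t].
have Fl : sublinear (fun z => inf (F z)).
  split=> [z w|r z r0].
    apply/ler_addgt0Pr => e e0; have e2 : 0 < e / 2 by rewrite divr_gt0.
    have [_ [t /= t0 <-] ht] := inf_adherent e2 (Finf z).
    have [_ [s /= s0 <-] hs] := inf_adherent e2 (Finf w).
    have := Fle (z + w) (t + s) (addr_ge0 t0 s0).
    have := ql.1 (z + t *: y) (w + s *: y).
    by rewrite scalerDl addrACA; lra.
  rewrite -ler_pdivrMl //; apply: lb_le_inf; first exact: (Finf z).1.
  move=> _ [t /= t0 <-]; rewrite ler_pdivrMl //.
  have rt : 0 <= r * t by rewrite mulr_ge0 // ltW.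
  have := Fle (r *: z) (r * t) rt.
  by rewrite -scalerA -scalerDr (sublinearZ _ ql (ltW r0)); lra.
have Fq : (fun z => inf (F z)) = q.
  apply: qmin => // z.
  by have := Fle z 0 (lexx _); rewrite scale0r addr0 mul0r subr0.
apply/eqP; rewrite eq_le ql.1 /=.
by have := Fle x 1 ler01; rewrite (congr1 (fun f => f x) Fq) scale1r mul1r; lra.
Qed.

(** Zorn's lemma, with the order reversed, gives a minimal sublinear functional below [p]. A
    nonempty chain is bounded by its pointwise infimum, the empty one by [p]; minimality forces
    additivity, hence linearity. *)
Lemma hahn_banach_sublinear p : sublinear p ->
  exists2 f : V -> R, (forall x, f x <= p x) &
    forall r x y, f (r *: x + y) = r * f x + f y.
Proof.
move=> pl; pose Q := {q : V -> R | sublinear q /\ forall x, q x <= p x}.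
pose le (q q' : Q) := `[< forall x, sval q' x <= sval q x >].
have [|||A Atot|[q [ql qp]] qmin] := @Zorn Q le.
- by move=> t; apply/asboolP.
- move=> r s t /asboolP rs /asboolP st; apply/asboolP => x.
  exact: le_trans (st x) (rs x).
- move=> [s hs] [t ht] /asboolP st /asboolP ts; apply: eq_exist.
  by apply/funext => x; apply/eqP; rewrite eq_le st ts.
- have [[a Aa]|/forallNP A0] := pselect (exists a, A a); last first.
    by exists (exist _ p (conj pl (fun x => lexx (p x)))) => s /A0.
  pose F x := [set sval (q : Q) x | q in A].
  have Finf x : has_inf (F x).
    split; first by exists (sval a x), a.
    exists (- p (- x)) => _ [[q [ql qp]] Aq <-] /=.
    by have := sublinearN_ge x ql; have := qp (- x); lra.
  have Fle x (q : Q) : A q -> inf (F x) <= sval q x.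
    by move=> Aq; apply: ge_inf; [exact: (Finf x).2 | exists q].
  have Fl : sublinear (fun x => inf (F x)).
    split=> [x y|r x r0].
      apply/ler_addgt0Pr => e e0; have e2 : 0 < e / 2 by rewrite divr_gt0.
      have [_ [s As <-] hs] := inf_adherent e2 (Finf x).
      have [_ [t At <-] ht] := inf_adherent e2 (Finf y).
      (* The two near-optimal functionals are comparable, so the smaller one serves at both
         points. *)
      have [/asboolP st|/asboolP ts] := Atot s t As At.
        have := Fle (x + y) t At; have := (svalP t).1.1 x y.
        by have := st x; lra.
      have := Fle (x + y) s As; have := (svalP s).1.1 x y.
      by have := ts y; lra.
    rewrite -ler_pdivrMl //; apply: lb_le_inf; first exact: (Finf x).1.
    move=> _ [q Aq <-]; rewrite ler_pdivrMl //.
    exact: le_trans (Fle (r *: x) q Aq) ((svalP q).1.2 _ _ r0).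
  have Fp x : inf (F x) <= p x by exact: le_trans (Fle x a Aa) ((svalP a).2 x).
  exists (exist (fun q => sublinear q /\ forall x, q x <= p x) _ (conj Fl Fp)).
  by move=> s As; apply/asboolP => x /=; exact: Fle.
have qD := minimal_sublinear_additive ql.
have {}qD : forall x y, q (x + y) = q x + q y.
  apply: qD => q' q'l q'q.
  have q'p x : q' x <= p x by exact: le_trans (q'q x) (qp x).
  by have [] := qmin (exist _ q' (conj q'l q'p)) (introT (asboolP _) q'q).
exists q => // r x y; rewrite qD; congr (_ + _).
have [r0|r0] := leP 0 r; first exact: sublinearZ.
have qN z : q (- z) = - q z.
  by apply/eqP; rewrite -addr_eq0 -qD addNr sublinear0.
by rewrite -(opprK r) scaleNr qN sublinearZ ?mulNr // oppr_ge0 ltW.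
Qed.

End HahnBanach.

(** Restriction of scalars to the reals, on a type of its own, so that the real Hahn-Banach theorem
    applies to [A]. *)
Definition real_module (R : realType) (A : cstarAlgType R) : Type := A.

Section RealModule.
Variables (R : realType) (A : cstarAlgType R).

HB.instance Definition _ := GRing.Zmodule.on (real_module A).

Let rscale (r : R) (x : real_module A) : real_module A := (r%:C *: (x : A) : A).

Let rscaleA a b v : rscale a (rscale b v) = rscale (a * b) v.
Proof. by rewrite /rscale scalerA -rmorphM. Qed.
Let rscale1 : left_id 1 rscale.
Proof. by move=> v; rewrite /rscale rmorph1 scale1r. Qed.
Let rscaleDr : right_distributive rscale +%R.
Proof. by move=> a u v; rewrite /rscale scalerDr. Qed.
Let rscaleDl v : {morph rscale^~ v : a b / a + b}.
Proof. by move=> a b; rewrite /rscale rmorphD scalerDl. Qed.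

HB.instance Definition _ := GRing.Zmodule_isLmodule.Build R (real_module A)
  rscaleA rscale1 rscaleDr rscaleDl.

Lemma rscaleE (r : R) (x : A) : r *: (x : real_module A) = sc A r * x.
Proof. by rewrite scE. Qed.

End RealModule.

Section StateExists.
Variables (R : realType) (A : cstarAlgType R).
Implicit Types x y : A.
Local Notation sc := (@sc R A).
Local Notation ii := (@ii R A).

(* The complexification of a real functional dominated by [specsup]. *)
Lemma state_exists : exists f : A -> R[i],
  [/\ forall (c : R[i]) x y, f (c *: x + y) = c * f x + f y,
      forall y, 0 <= f (star y * y) & f 1 = 1].
Proof.
have [|f fle flin] := @hahn_banach_sublinear R (real_module A) (@specsup R A).
  split=> [x y|r x r0]; first exact: specsupD.
  by rewrite rscaleE specsupZ // ltW.
have fD x y : f (x + y) = f x + f y.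
  by have := flin 1 x y; rewrite scale1r mul1r.
have f0 : f 0 = 0 by apply: (addrI (f 0)); rewrite -fD !addr0.
have fN x : f (- x) = - f x.
  by apply/eqP; rewrite -addr_eq0 -fD addNr f0.
have fZ r x : f (sc r * x) = r * f x.
  by have := flin r x 0; rewrite addr0 f0 addr0 rscaleE.
have f1 : f 1 = 1.
  apply/eqP; rewrite eq_le; apply/andP; split.
    by have := specsup_sc A 1; rewrite sc1; exact: le_trans.
  have := fle (-1); rewrite fN => le1.
  by have := specsup_sc A (-1); rewrite scN sc1; lra.
(* Averaging with the adjoint makes the functional vanish on [i b] for self-adjoint [b], so its
   complexification is real there. *)
pose g x := (f x + f (star x)) / 2.
have gD x y : g (x + y) = g x + g y by rewrite /g starD !fD; lra.
have gZ r x : g (sc r * x) = r * g x.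
  by rewrite /g starM star_sc scC !fZ; lra.
have gN x : g (- x) = - g x by rewrite /g starN !fN; lra.
exists (fun x => g x +i* (- g (ii * x))); split.
- move=> [a b] x y.
  have -> : (a +i* b) *: x = sc a * x + sc b * (ii * x).
    rewrite !scE /ii -scalerAl mul1r scalerA -scalerDl; congr (_ *: _).
    by apply/eqP; rewrite eq_complex /=; apply/andP; split; apply/eqP; ring.
  have -> : ii * (sc a * x + sc b * (ii * x) + y) =
     sc a * (ii * x) - sc b * x + ii * y.
    rewrite !mulrDr !(scCA _ ii) (mulrA ii ii) ii_sqr mulN1r mulrN.
    by [].
  rewrite !gD gN !gZ; apply/eqP; rewrite eq_complex /=.
  by apply/andP; split; apply/eqP; ring.
- move=> y; set b := star y * y.
  have bs : star b = b by rewrite /b starM starK.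
  rewrite lecE /=; apply/andP; split.
    by rewrite /g starM bs star_ii mulrN iiC fN subrr mul0r oppr0.
  rewrite /g bs; have := fle (- b); rewrite fN; have := pos_starM y.
  by rewrite /pos -/b; lra.
- apply/eqP; rewrite eq_complex /=; apply/andP; split; apply/eqP.
    by rewrite /g star1 f1; lra.
  by rewrite /g mulr1 star_ii fN subrr mul0r oppr0.
Qed.

End StateExists.

(** * The operator norm on matrices *)

(** Used for submultiplicativity of a norm defined as an infimum. If [z > a b], the chosen [e] makes
    [(a + e) (b + e)] smaller than [z]. *)
Lemma le_mul_above (R : realFieldType) (a b z : R) : 0 <= a -> 0 <= b ->
  (forall l m, a < l -> b < m -> z <= l * m) -> z <= a * b.
Proof.
move=> a0 b0 h; rewrite leNgt; apply/negP => lt.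
pose d := z - a * b; pose e := d / (a + b + 1 + d).
have d0 : 0 < d by rewrite subr_gt0.
have D0 : 0 < a + b + 1 + d by lra.
have e0 : 0 < e by rewrite divr_gt0.
have eE : e * (a + b + 1 + d) = d by rewrite divfK // lt0r_neq0.
have e1 : e < 1 by rewrite ltr_pdivrMr //; lra.
have := h (a + e) (b + e); rewrite !ltrDl e0 => /(_ isT isT).
have := mulr_gt0 e0 d0; rewrite /d in d0 eE *; nra.
Qed.

Lemma normc_ge0 (R : rcfType) (c : R[i]) : 0 <= Normc.normc c.
Proof. by case: c => a b; exact: sqrtr_ge0. Qed.

Lemma normc_gt0 (R : rcfType) (c : R[i]) : c != 0 -> 0 < Normc.normc c.
Proof.
move=> c0; rewrite lt_def normc_ge0 andbT; apply: contraNN c0 => /eqP.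
by move=> /Normc.eq0_normc ->.
Qed.

Section MatrixNorm.
Variables (R : realType) (T : cstarAlgType R) (n : nat).
Implicit Types (X Y : 'M[T]_n) (u v w : 'cV[T]_n) (l m : R).

Local Notation N := (@cstar_norm R T).
Local Notation sc := (@sc R T).

Lemma mxstarE p q (Z : 'M[T]_(p, q)) i j : mxstar Z i j = star (Z j i).
Proof. by rewrite !mxE. Qed.

Lemma mxstar_mul p q r (Y : 'M[T]_(p, q)) (Z : 'M[T]_(q, r)) :
  mxstar (Y *m Z) = mxstar Z *m mxstar Y.
Proof.
apply/matrixP => i j; rewrite mxstarE !mxE star_sum.
by apply: eq_bigr => k _; rewrite starM !mxstarE.
Qed.

Lemma mxstarK p q (Z : 'M[T]_(p, q)) : mxstar (mxstar Z) = Z.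
Proof. by apply/matrixP => i j; rewrite !mxstarE starK. Qed.

(** The [T]-valued inner product of the Hilbert module of columns over [T], conjugate linear in
    [v]. *)
Definition ip v w : T := (mxstar v *m w) 0 0.

Lemma ipE v w : ip v w = \sum_i star (v i 0) * w i 0.
Proof. by rewrite /ip mxE; apply: eq_bigr => i _; rewrite mxstarE. Qed.

Lemma ip_adj X v w : ip (X *m v) w = ip v (mxstar X *m w).
Proof. by rewrite /ip mxstar_mul mulmxA. Qed.

Lemma ip_adjr X v w : ip v (X *m w) = ip (mxstar X *m v) w.
Proof. by rewrite ip_adj mxstarK. Qed.

Lemma ipDl u v w : ip (u + v) w = ip u w + ip v w.
Proof.
by rewrite !ipE -big_split; apply: eq_bigr => i _; rewrite mxE starD mulrDl.
Qed.

Lemma ipDr u v w : ip u (v + w) = ip u v + ip u w.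
Proof. by rewrite /ip mulmxDr mxE. Qed.

Lemma ipZl r v w : ip (sc r *: v) w = sc r * ip v w.
Proof.
rewrite !ipE mulr_sumr; apply: eq_bigr => i _.
by rewrite mxE starM star_sc scC mulrA.
Qed.

Lemma ipZr r v w : ip v (sc r *: w) = sc r * ip v w.
Proof.
by rewrite !ipE mulr_sumr; apply: eq_bigr => i _; rewrite mxE scCA.
Qed.

Lemma pos_ip v : pos (ip v v).
Proof. by rewrite ipE; apply: pos_sum => i _; exact: pos_starM. Qed.

(** Expand the inner square of [l v - w] and divide by [l]. This stands in for the Cauchy-Schwarz
    inequality. *)
Lemma ip_young l v w : 0 < l ->
  pos (sc l * ip v v + sc l^-1 * ip w w - (ip v w + ip w v)).
Proof.
move=> l0; have lV : 0 <= l^-1 by rewrite invr_ge0 ltW.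
have := posZ lV (pos_ip (sc l *: v + sc (-1) *: w)); congr (pos _).
rewrite !(ipDl, ipDr) !(ipZl, ipZr) !mulrDr !scVK ?lt0r_neq0 //.
by rewrite scN sc1 !mulN1r !mulrN !scVK ?lt0r_neq0 // opprK; ncring.
Qed.

(** Boundedness of [X] on the Hilbert module, compared in the order of [T] and not through norms of
    vectors. Since [l] is positive, one may divide by it. *)
Definition opbound l X :=
  0 < l /\ forall v, pos (sc (l ^+ 2) * ip v v - ip (X *m v) (X *m v)).

Lemma opbound_mono l m X : l <= m -> opbound l X -> opbound m X.
Proof.
move=> lm [l0 h]; split=> [|v]; first exact: lt_le_trans lm.
have -> : sc (m ^+ 2) * ip v v - ip (X *m v) (X *m v) =
  sc (m ^+ 2 - l ^+ 2) * ip v v +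
  (sc (l ^+ 2) * ip v v - ip (X *m v) (X *m v)) by rewrite scB; ncring.
apply: posD => //; apply: posZ (pos_ip v).
by rewrite subr_ge0 lerXn2r // nnegrE; lra.
Qed.

Lemma opbound0 l : 0 < l -> opbound l 0.
Proof.
move=> l0; split=> // v; rewrite mul0mx {2}/ip mulmx0 [X in _ - X]mxE subr0.
by apply: posZ (pos_ip v); rewrite exprn_ge0 // ltW.
Qed.

(** The cross terms are absorbed by [ip_young] with weight [m / l], for which [(1 + m / l) l^2 + (1
    + l / m) m^2 = (l + m)^2]. *)
Lemma opboundD l m X Y : opbound l X -> opbound m Y -> opbound (l + m) (X + Y).
Proof.
move=> [l0 hX] [m0 hY]; split=> [|v]; first by rewrite addr_gt0.
have ml : 0 < m / l by rewrite divr_gt0.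
have lm : 0 < l / m by rewrite divr_gt0.
have pX : 0 <= 1 + m / l by lra.
have pY : 0 <= 1 + l / m by lra.
have := posD (posD (posZ pX (hX v)) (posZ pY (hY v))) (ip_young (X *m v) (Y *m v) ml).
rewrite invf_div mulmxDl !(ipDl, ipDr) !mulrDr !mulrN !mulrA -!scM.
have -> : (l + m) ^+ 2 = (1 + m / l) * l ^+ 2 + (1 + l / m) * m ^+ 2.
  by field; rewrite !lt0r_neq0.
rewrite (scD _ (_ * _)) !(scM _ (1 + _)) (scD _ 1 (m / l)) (scD _ 1 (l / m)) sc1.
by congr (pos _); ncring.
Qed.

Lemma opboundM l m X Y : opbound l X -> opbound m Y -> opbound (l * m) (X *m Y).
Proof.
move=> [l0 hX] [m0 hY]; split=> [|v]; first by rewrite mulr_gt0.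
have l2 : 0 <= l ^+ 2 by rewrite exprn_ge0 // ltW.
have := posD (posZ l2 (hY v)) (hX (Y *m v)); congr (pos _).
rewrite exprMn (scM _ (l ^+ 2)) -!mulmxA mulrBr mulrA.
ncring.
Qed.

(** For [w = X X^* v], twice the inner square of [X^* v] is the cross term of [v] and [w]. Apply
    [ip_young] with weight [l^2] and bound [w] by [X^* v]; one copy cancels. *)
Lemma opbound_mxstar l X : opbound l X -> opbound l (mxstar X).
Proof.
move=> [l0 h]; split=> // v; have l2 : 0 < l ^+ 2 by rewrite exprn_gt0.
have lV : 0 <= (l ^+ 2)^-1 by rewrite invr_ge0 ltW.
have := posD (ip_young v (X *m (mxstar X *m v)) l2)
  (posZ lV (h (mxstar X *m v))); congr (pos _).
rewrite (ip_adjr X v) (ip_adj X _ v) mulrBr scVK ?lt0r_neq0 //; ncring.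
Qed.

(** The inner square of [X v] is the inner product of [v] and [X^* X v]; [ip_young] with weight
    [l^2] bounds it. This is the nontrivial half of the C*-identity. *)
Lemma opbound_sqr l X : 0 < l -> opbound (l ^+ 2) (mxstar X *m X) -> opbound l X.
Proof.
move=> l0 [l2 h]; split=> // v.
have lV : 0 <= (l ^+ 2)^-1 by rewrite invr_ge0 ltW.
have half : 0 <= 2^-1 :> R by rewrite invr_ge0.
have := posZ half (posD (ip_young v (mxstar X *m X *m v) l2) (posZ lV (h v))).
congr (pos _); rewrite mulrBr -!mulmxA -(ip_adj X v) -(ip_adjr X _ v).
rewrite (expr2 (l ^+ 2)) scM -mulrA scVK ?lt0r_neq0 //.
rewrite -[RHS](@scVK _ _ 2) //; congr (_ * _).
by rewrite -[2%:R in RHS]/(1 + 1) scD sc1; ncring.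
Qed.

Lemma opboundZ l (c : R[i]) X : c != 0 -> opbound l X ->
  opbound (Normc.normc c * l) (mxscale c X).
Proof.
move=> c0 [l0 h]; have cp : 0 < Normc.normc c.
  exact: normc_gt0.
split=> [|v]; first by rewrite mulr_gt0.
have c2 : 0 <= Normc.normc c ^+ 2 by rewrite sqr_ge0.
have := posZ c2 (h v); congr (pos _).
rewrite mulrBr mulrA -scM -exprMn; congr (_ - _).
have -> : mxscale c X *m v = (c *: 1) *: (X *m v).
  apply/matrixP => i j; rewrite !mxE mulr_sumr; apply: eq_bigr => k _.
  by rewrite mxE -!scalerAl mul1r.
rewrite !ipE mulr_sumr; apply: eq_bigr => i _.
rewrite [in RHS]mxE starM starZ star1 -!scalerAl -!scalerAr mul1r mulr1 -scalerAl.
rewrite ?mul1r scalerA; congr (_ *: _).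
case: (c) => a b; rewrite /Normc.normc sqr_sqrtr ?addr_ge0 ?sqr_ge0 //=.
by apply/eqP; rewrite eq_complex /=; apply/andP; split; apply/eqP; ring.
Qed.

Lemma specsup_sum_term (F : 'I_n -> T) i : (forall j, pos (F j)) ->
  specsup (F i) <= specsup (\sum_j F j).
Proof.
move=> F0; apply: specsup_mono; rewrite (bigD1 i) //= opprD addrA subrr add0r.
exact: pos_sum.
Qed.

(** On the [j]-th basis vector the bound controls a sum of positive terms, one of which is the
    square of the entry; [cnorm_le_specsup] passes from the order to the norm. *)
Lemma opbound_entry l X i j : opbound l X -> N (X i j) <= l.
Proof.
move=> [l0 h]; pose v : 'cV[T]_n := delta_mx j 0.
have v1 : ip v v = 1.
  rewrite ipE (bigD1 j) //= big1 => [|k kj].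
    by rewrite !mxE !eqxx addr0 mulr1 star1.
  by rewrite !mxE (negPf kj) mulr0.
have Xv k : (X *m v) k 0 = X k j.
  rewrite mxE (bigD1 j) //= big1 => [|q qj].
    by rewrite mxE !eqxx mulr1 addr0.
  by rewrite mxE (negPf qj) mulr0.
have le1 : specsup (star (X i j) * X i j) <= l ^+ 2.
  have := h v; rewrite v1 mulr1 => /pos_specsup; apply: le_trans.
  rewrite ipE -!(Xv i).
  apply: (@specsup_sum_term (fun k => star ((X *m v) k 0) * (X *m v) k 0)) => k.
  exact: pos_starM.
have : N (star (X i j) * X i j) <= l ^+ 2.
  apply: cnorm_le_specsup le1 _; first by rewrite starM starK.
  by have := pos_starM (X i j); rewrite /pos; have := sqr_ge0 l; lra.
by rewrite cstar_norm_starM ler_pXn2r // ?nnegrE ?cnorm_ge0 // ltW.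
Qed.

(** With [opboundD], this shows that every matrix has a bound, so that the infimum in [opnorm] is
    over a nonempty set. *)
Lemma opbound_delta l x i j : N x <= l -> 0 < l ->
  opbound l (x *: delta_mx i j : 'M[T]_n).
Proof.
move=> xl l0; split=> // v.
have Dv k : ((x *: delta_mx i j : 'M[T]_n) *m v) k 0 = (x * v j 0) *+ (k == i).
  rewrite mxE (bigD1 j) //= big1 => [|q qj].
    by rewrite !mxE eqxx andbT addr0; case: (k == i); rewrite ?mulr1 ?mulr0 ?mul0r.
  by rewrite !mxE (negPf qj) andbF mulr0 mul0r.
have -> : ip ((x *: delta_mx i j : 'M[T]_n) *m v) ((x *: delta_mx i j : 'M[T]_n) *m v) =
    star (v j 0) * (star x * x) * v j 0.
  rewrite ipE (bigD1 i) //= big1 => [|q qi].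
    by rewrite !Dv eqxx mulr1n addr0 starM !mulrA.
  by rewrite !Dv (negPf qi) mulr0.
have l2 : 0 <= l ^+ 2 by rewrite exprn_ge0 // ltW.
have -> : sc (l ^+ 2) * ip v v - star (v j 0) * (star x * x) * v j 0 =
    sc (l ^+ 2) * (\sum_(k | k != j) star (v k 0) * v k 0) +
    star (v j 0) * (sc (l ^+ 2) - star x * x) * v j 0.
  by rewrite ipE (bigD1 j) //= !(mulrBr, mulrDr) mulrBl scC -mulrA; ncring.
apply: posD; first by apply: posZ l2 _; apply: pos_sum => k _; exact: pos_starM.
apply: pos_conj; first by rewrite starB star_sc starM starK.
apply: specsup_pos; apply: le_trans (specsup_norm _) _.
by rewrite cstar_norm_starM lerXn2r // nnegrE ?cnorm_ge0 // ltW.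
Qed.

Definition opnorm X : R := inf [set l | opbound l X].

Lemma opnorm_has_inf X : has_inf [set l | opbound l X].
Proof.
split; last by exists 0 => l [/ltW].
rewrite (matrix_sum_delta X).
apply: (big_ind (fun Y => exists l, opbound l Y)).
- by exists 1; exact: opbound0.
- by move=> Y Z [l Yl] [m Zm]; exists (l + m); exact: opboundD.
move=> i _; apply: (big_ind (fun Y => exists l, opbound l Y)).
- by exists 1; exact: opbound0.
- by move=> Y Z [l Yl] [m Zm]; exists (l + m); exact: opboundD.
move=> j _; exists (N (X i j) + 1); apply: opbound_delta.
  by rewrite lerDl.
by rewrite ltr_wpDl // cnorm_ge0.
Qed.

Lemma opnorm_le l X : opbound l X -> opnorm X <= l.
Proof. by apply: ge_inf; exact: (opnorm_has_inf X).2. Qed.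

Lemma opnorm_lt l X : opnorm X < l -> opbound l X.
Proof.
move=> lt; have e0 : 0 < l - opnorm X by rewrite subr_gt0.
have [m /= Xm] := inf_adherent e0 (opnorm_has_inf X).
by rewrite subrKC => /ltW ml; exact: opbound_mono Xm.
Qed.

Lemma opnorm_ge0 X : 0 <= opnorm X.
Proof. by apply: lb_le_inf => [|l [/ltW]//]; exact: (opnorm_has_inf X).1. Qed.

Lemma opnorm_leP X c : (forall l, c < l -> opbound l X) -> opnorm X <= c.
Proof.
move=> h; apply/ler_addgt0Pr => e e0; apply/opnorm_le/h.
by rewrite ltrDl.
Qed.

Lemma opnorm0 : opnorm 0 = 0.
Proof.
apply/eqP; rewrite eq_le opnorm_ge0 andbT.
by apply: opnorm_leP => l; exact: opbound0.
Qed.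

Lemma opnormD X Y : opnorm (X + Y) <= opnorm X + opnorm Y.
Proof.
apply/ler_addgt0Pr => e e0.
have -> : opnorm X + opnorm Y + e = (opnorm X + e / 2) + (opnorm Y + e / 2) by lra.
by apply/opnorm_le/opboundD; apply: opnorm_lt; rewrite ltrDl divr_gt0.
Qed.

Lemma opnormM X Y : opnorm (X *m Y) <= opnorm X * opnorm Y.
Proof.
apply: le_mul_above => [||l m Xl Ym]; try exact: opnorm_ge0.
by apply/opnorm_le/opboundM; exact: opnorm_lt.
Qed.

Lemma opnorm_mxstar_le X : opnorm (mxstar X) <= opnorm X.
Proof. by apply: opnorm_leP => l /opnorm_lt; exact: opbound_mxstar. Qed.

Lemma opnorm_starM X : opnorm (mxstar X *m X) = opnorm X ^+ 2.
Proof.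
apply/eqP; rewrite eq_le; apply/andP; split.
  rewrite (le_trans (opnormM _ _)) // expr2 ler_wpM2r ?opnorm_ge0 //.
  exact: opnorm_mxstar_le.
apply/ler_addgt0Pr => e e0; set c := _ + e.
have c0 : 0 < c by rewrite ltr_wpDl // opnorm_ge0.
have h : opnorm X <= Num.sqrt c.
  apply/opnorm_le/opbound_sqr; first by rewrite sqrtr_gt0.
  by rewrite sqr_sqrtr 1?ltW //; apply: opnorm_lt; rewrite ltrDl.
rewrite -[leRHS](sqr_sqrtr (ltW c0)) lerXn2r // nnegrE ?opnorm_ge0 //.
Qed.

Lemma opnormZ (c : R[i]) X : opnorm (mxscale c X) = Normc.normc c * opnorm X.
Proof.
have [->|c0] := eqVneq c 0.
  have -> : mxscale 0 X = 0 by apply/matrixP => i j; rewrite !mxE scale0r.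
  by rewrite opnorm0 Normc.normc0 mul0r.
have le (d : R[i]) Y : d != 0 -> opnorm (mxscale d Y) <= Normc.normc d * opnorm Y.
  move=> d0; have dp : 0 < Normc.normc d.
    exact: normc_gt0.
  rewrite -ler_pdivrMl //; apply: lb_le_inf; first exact: (opnorm_has_inf Y).1.
  by move=> l /(opboundZ d0)/opnorm_le; rewrite ler_pdivrMl.
apply/eqP; rewrite eq_le le //=.
have {1}-> : X = mxscale c^-1 (mxscale c X).
  by apply/matrixP => i j; rewrite !mxE scalerA mulVf // scale1r.
have ci : c^-1 != 0 by rewrite invr_eq0.
have := le c^-1 (mxscale c X) ci; rewrite Normc.normcV.
have cp : 0 < Normc.normc c.
  exact: normc_gt0.
by rewrite ler_pdivlMl.
Qed.

Lemma entry_opnorm X i j : N (X i j) <= opnorm X.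
Proof.
apply: lb_le_inf; first exact: (opnorm_has_inf X).1.
by move=> l; exact: opbound_entry.
Qed.

(** Together with [entry_opnorm], it identifies convergence in norm with entrywise convergence, from
    which completeness follows. *)
Lemma opnorm_entries X : opnorm X <= \sum_i \sum_j N (X i j).
Proof.
rewrite {1}(matrix_sum_delta X).
apply: (big_ind2 (fun Y r => opnorm Y <= r)).
- by rewrite opnorm0.
- by move=> Y y Z z Yy Zz; exact: le_trans (opnormD Y Z) (lerD Yy Zz).
move=> i _; apply: (big_ind2 (fun Y r => opnorm Y <= r)).
- by rewrite opnorm0.
- by move=> Y y Z z Yy Zz; exact: le_trans (opnormD Y Z) (lerD Yy Zz).
move=> j _; apply: opnorm_leP => l lt; apply: opbound_delta; first exact: ltW.
exact: le_lt_trans (cnorm_ge0 _) lt.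
Qed.

End MatrixNorm.

(** * Square matrices of positive size as a C*-algebra *)

Definition cstar_mx (R : realType) (T : cstarAlgType R) (k : nat) : Type :=
  'M[T]_k.+1.

Section MatrixCstarAlgebra.
Variables (R : realType) (T : cstarAlgType R) (k : nat).
Local Notation M := (cstar_mx T k).
Implicit Types (X Y : M) (c : R[i]).

HB.instance Definition _ := GRing.NzRing.copy M 'M[T]_k.+1.

Let scale c X : M := mxscale c X.

Let scaleA a b X : scale a (scale b X) = scale (a * b) X.
Proof. by apply/matrixP => i j; rewrite !mxE scalerA. Qed.
Let scale1 : left_id 1 scale.
Proof. by move=> X; apply/matrixP => i j; rewrite !mxE scale1r. Qed.
Let scaleDr : right_distributive scale +%R.
Proof. by move=> a X Y; apply/matrixP => i j; rewrite !mxE scalerDr. Qed.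
Let scaleDl X : {morph scale^~ X : a b / a + b}.
Proof. by move=> a b; apply/matrixP => i j; rewrite !mxE scalerDl. Qed.

HB.instance Definition _ :=
  GRing.Zmodule_isLmodule.Build R[i] M scaleA scale1 scaleDr scaleDl.

Let scaleAl c X Y : c *: (X * Y) = (c *: X) * Y.
Proof.
apply/matrixP => i j; rewrite !mxE scaler_sumr.
by apply: eq_bigr => q _; rewrite mxE scalerAl.
Qed.

HB.instance Definition _ := GRing.Lmodule_isLalgebra.Build R[i] M scaleAl.

Let scaleAr c X Y : c *: (X * Y) = X * (c *: Y).
Proof.
apply/matrixP => i j; rewrite !mxE scaler_sumr.
by apply: eq_bigr => q _; rewrite mxE scalerAr.
Qed.

HB.instance Definition _ := GRing.Lalgebra_isAlgebra.Build R[i] M scaleAr.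

Let mstar X : M := mxstar X.
Let mnorm X : R := opnorm X.

Let mstarD X Y : mstar (X + Y) = mstar X + mstar Y.
Proof. by apply/matrixP => i j; rewrite !mxE starD. Qed.
Let mstarZ c X : mstar (c *: X) = c^*%C *: mstar X.
Proof. by apply/matrixP => i j; rewrite !mxE starZ. Qed.
Let mstarM X Y : mstar (X * Y) = mstar Y * mstar X.
Proof. exact: mxstar_mul. Qed.
Let mstarK : involutive mstar.
Proof. by move=> X; exact: mxstarK. Qed.
Let mnormD X Y : mnorm (X + Y) <= mnorm X + mnorm Y.
Proof. exact: opnormD. Qed.
Let mnormZ c X : mnorm (c *: X) = Normc.normc c * mnorm X.
Proof. exact: opnormZ. Qed.
Let mnorm0_eq0 X : mnorm X = 0 -> X = 0.
Proof.
move=> X0; apply/matrixP => i j; rewrite mxE; apply: cstar_norm0_eq0.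
by apply/eqP; rewrite eq_le cnorm_ge0 andbT -X0; exact: entry_opnorm.
Qed.
Let mnormM X Y : mnorm (X * Y) <= mnorm X * mnorm Y.
Proof. exact: opnormM. Qed.
Let mnorm_starM X : mnorm (mstar X * X) = mnorm X ^+ 2.
Proof. exact: opnorm_starM. Qed.

Let mcomplete (u : nat -> M) :
  (forall e : R, 0 < e -> exists N : nat, forall m n : nat,
    (N <= m)%N -> (N <= n)%N -> mnorm (u m - u n) < e) ->
  exists l : M, forall e : R, 0 < e -> exists N : nat, forall n : nat,
    (N <= n)%N -> mnorm (u n - l) < e.
Proof.
move=> cauchy; have lim i j : exists l : T, forall e : R, 0 < e ->
    exists N : nat, forall n : nat, (N <= n)%N -> cstar_norm (u n i j - l) < e.
  apply: cstar_complete => e /cauchy[N hN]; exists N => m n Nm Nn.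
  apply: le_lt_trans (hN m n Nm Nn).
  by have := entry_opnorm (u m - u n) i j; rewrite !mxE.
pose l : M := \matrix_(i, j) projT1 (cid (lim i j)).
(* There are [(k + 1)^2] entries, each within [d]; the extra 1 in the denominator makes the total
   strictly less than [e]. *)
exists l => e e0; pose d := e / (k.+1 * k.+1).+1%:R.
have d0 : 0 < d by rewrite divr_gt0.
have hl i j := projT2 (cid (projT2 (cid (lim i j)) d d0)).
pose N := \max_i \max_j projT1 (cid (projT2 (cid (lim i j)) d d0)).
exists N => n Nn; apply: le_lt_trans (opnorm_entries _) _.
apply: (@le_lt_trans _ _ (\sum_(i < k.+1) \sum_(j < k.+1) d)).
  apply: ler_sum => i _; apply: ler_sum => j _.
  rewrite !mxE; apply/ltW/hl; apply: leq_trans Nn.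
  rewrite /N; apply: leq_trans (leq_bigmax i).
  exact: (leq_bigmax (F := fun j => projT1 (cid (projT2 (cid (lim i j)) d d0)))).
rewrite !sumr_const !card_ord -mulrnA -mulr_natr /d mulrAC ltr_pdivrMr //.
by rewrite ltr_pM2l // ltr_nat.
Qed.

HB.instance Definition _ := isCstarAlgebra.Build R M mstarD mstarZ mstarM mstarK
  mnormD mnormZ mnorm0_eq0 mnormM mnorm_starM mcomplete.

(** This is what the C*-structure on matrices is built for: [sum_starM] is applied in the matrix
    algebra itself. *)
Lemma mxpositiveD (X Y : 'M[T]_k.+1) :
  mxpositive X -> mxpositive Y -> mxpositive (X + Y).
Proof.
by move=> [V ->] [W ->]; have [Z] := sum_starM (V : M) (W : M); exists Z.
Qed.

End MatrixCstarAlgebra.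

(** * C*-convexity of [CP] and of [cconv] *)

Section CstarConvexity.
Variables (R : realType) (A T : cstarAlgType R) (S : opSystem A).
Implicit Types (K L : set (S -> T)) (Phi Psi : S -> T).

Lemma mxpositive_sum k (I : Type) (s : seq I) (F : I -> 'M[T]_k.+1) :
  (forall i, mxpositive (F i)) -> mxpositive (\sum_(i <- s) F i).
Proof.
move=> F0; apply: (big_ind (@mxpositive R T k.+1)) => //.
- by exists 0; rewrite mulmx0.
- exact: mxpositiveD.
Qed.

Lemma mxpositive_conj k (a : T) (X : 'M[T]_k) :
  mxpositive X -> mxpositive (map_mx (fun x => star a * x * a) X).
Proof.
move=> [Y ->]; exists (map_mx (fun y => y * a) Y).
apply/matrixP => i j; rewrite !mxE mulr_sumr mulr_suml.
by apply: eq_bigr => q _; rewrite !mxE starM !mulrA.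
Qed.

(** This puts [CP] itself among the sets intersected in [cconv K], for [K] contained in [CP]. *)
Lemma CP_cstar_convex : cstar_convex (CP T S).
Proof.
move=> n Phi a PhiCP _; split=> [c x y|k s s0].
  rewrite scaler_sumr -big_split; apply: eq_bigr => i _ /=.
  by rewrite (PhiCP i).1 mulrDr mulrDl -scalerAr -scalerAl.
have -> : map_mx (fun x => \sum_i star (a i) * Phi i x * a i) s =
    \sum_i map_mx (fun x => star (a i) * x * a i) (map_mx (Phi i) s).
  apply/matrixP => i j; rewrite !mxE summxE; apply: eq_bigr => q _.
  by rewrite !mxE.
by apply: mxpositive_sum => i; apply/mxpositive_conj/(PhiCP i).2.
Qed.

Lemma cconv_CP K : K `<=` CP T S -> cconv K `<=` CP T S.
Proof.
move=> KCP Phi; apply; split => //; split => //; exact: CP_cstar_convex.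
Qed.

Lemma cconv_cstar_convex K : cstar_convex (cconv K).
Proof.
move=> n Phi a PhiK asum M [[MCP Mconv] KM].
by apply: (Mconv n Phi a) => // i; apply: PhiK; split => //; split.
Qed.

(** The scalar coefficients [sqrt r] and [sqrt (1 - r)] are central and self-adjoint, so the
    C*-convex combination they define is an ordinary one. *)
Lemma cconv_convex K Phi Psi (r : R) : 0 <= r -> r <= 1 ->
  cconv K Phi -> cconv K Psi ->
  cconv K (fun x => sc T r * Phi x + sc T (1 - r) * Psi x).
Proof.
move=> r0 r1 KPhi KPsi.
pose w (i : 'I_2) : R := if i == 0 then r else 1 - r.
pose F (i : 'I_2) : S -> T := if i == 0 then Phi else Psi.
have w0 i : 0 <= w i by rewrite /w; case: ifP => // _; rewrite subr_ge0.
have sq i : sc T (Num.sqrt (w i)) * sc T (Num.sqrt (w i)) = sc T (w i).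
  by rewrite -scM -expr2 sqr_sqrtr.
have FK i : cconv K (F i) by rewrite /F; case: ifP.
have wsum : \sum_i star (sc T (Num.sqrt (w i))) * sc T (Num.sqrt (w i)) = 1.
  by rewrite !big_ord_recl big_ord0 addr0 !star_sc !sq -scD /w /= subrKC sc1.
have := cconv_cstar_convex FK wsum.
congr (cconv K _); apply/funext => x.
rewrite !big_ord_recl big_ord0 addr0 !star_sc -!mulrA !(scC _ (F _ x)) !mulrA !sq.
by [].
Qed.

End CstarConvexity.

(** * Separation of a convex set from the origin in finite dimension *)

Section Separation.
Variables (R : realType) (m : nat).
Implicit Types (x y v w : 'rV[R]_m) (r l : R).

Let nrm x : R := \sum_j `|x 0 j|.

Let nrmD x y : nrm (x + y) <= nrm x + nrm y.
Proof. by rewrite -big_split; apply: ler_sum => j _; rewrite mxE ler_normD. Qed.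

Let nrmZ r x : 0 <= r -> nrm (r *: x) = r * nrm x.
Proof.
move=> r0; rewrite /nrm mulr_sumr; apply: eq_bigr => j _.
by rewrite mxE normrM ger0_norm.
Qed.

Let nrmN x : nrm (- x) = nrm x.
Proof. by apply: eq_bigr => j _; rewrite mxE normrN. Qed.

(* Hahn-Banach for [q x = inf (|x + l v| - l d)] over [l > 0] and [v] in [D]. *)
Lemma convex_separation (D : set 'rV[R]_m) (d : R) : D !=set0 ->
  (forall v w (r : R), D v -> D w -> 0 <= r -> r <= 1 ->
    D (r *: v + (1 - r) *: w)) ->
  (forall v, D v -> d <= \sum_j `|v 0 j|) ->
  exists c : 'I_m -> R, forall v, D v -> d <= \sum_j c j * v 0 j.
Proof.
move=> [v0 Dv0] Dconv Dd.
pose F x := [set z | exists (l : R) v, [/\ 0 < l, D v & z = nrm (x + l *: v) - l * d]].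
have Finf x : has_inf (F x).
  split; first by exists (nrm (x + 1 *: v0) - 1 * d), 1, v0.
  exists (- nrm x) => _ [l [v [l0 Dv ->]]].
  have := nrmD (x + l *: v) (- x); rewrite addrC addKr nrmN (nrmZ _ (ltW l0)).
  have : l * d <= l * nrm v by rewrite ler_pM2l //; exact: Dd.
  by lra.
have Fle x l v : 0 < l -> D v -> inf (F x) <= nrm (x + l *: v) - l * d.
  by move=> l0 Dv; apply: ge_inf; [exact: (Finf x).2 | exists l, v].
have Fl : sublinear (fun x => inf (F x)).
  split=> [x y|r x r0].
    apply/ler_addgt0Pr => e e0; have e2 : 0 < e / 2 by rewrite divr_gt0.
    have [_ [l [v [l0 Dv ->]]] hv] := inf_adherent e2 (Finf x).
    have [_ [k [w [k0 Dw ->]]] hw] := inf_adherent e2 (Finf y).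
    have lk0 : 0 < l + k by rewrite addr_gt0.
    (* With this weight [l v + k w] is [l + k] times a convex combination, hence a multiple of a
       point of [D]. *)
    pose r := l / (l + k).
    have r0 : 0 <= r by rewrite divr_ge0 // ltW.
    have r1 : r <= 1 by rewrite ler_pdivrMr // mul1r lerDl ltW.
    have := Fle (x + y) (l + k) _ lk0 (Dconv v w r Dv Dw r0 r1).
    have -> : (l + k) *: (r *: v + (1 - r) *: w) = l *: v + k *: w.
      rewrite scalerDr !scalerA; congr (_ *: _ + _ *: _);
        by rewrite /r; field; rewrite lt0r_neq0.
    have := nrmD (x + l *: v) (y + k *: w).
    by rewrite addrACA; lra.
  rewrite -ler_pdivrMl //; apply: lb_le_inf; first exact: (Finf x).1.
  move=> _ [l [v [l0 Dv ->]]]; rewrite ler_pdivrMl //.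
  have := Fle (r *: x) (r * l) v (mulr_gt0 r0 l0) Dv.
  by rewrite -scalerA -scalerDr (nrmZ _ (ltW r0)); lra.
have [f fle flin] := hahn_banach_sublinear Fl.
have fD x y : f (x + y) = f x + f y.
  by have := flin 1 x y; rewrite scale1r mul1r.
have f0 : f 0 = 0 by apply: (addrI (f 0)); rewrite -fD !addr0.
have fZ r x : f (r *: x) = r * f x.
  by have := flin r x 0; rewrite !addr0 f0 addr0.
exists (fun j => f (delta_mx 0 j)) => v Dv.
have -> : \sum_j f (delta_mx 0 j) * v 0 j = f v.
  rewrite [in RHS](row_sum_delta v) (big_morph f fD f0).
  by apply: eq_bigr => j _; rewrite fZ mulrC.
(* At [- v], with scalar 1 and the point [v] itself, the norm term vanishes and [f (- v) <= - d]
   remains. *)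
have := fle (- v); have := Fle (- v) 1 v ltr01 Dv.
have -> : f (- v) = - f v by rewrite -scaleN1r fZ mulN1r.
rewrite scale1r addNr mul1r.
have -> : nrm 0 = 0 by rewrite /nrm big1 // => j _; rewrite mxE normr0.
lra.
Qed.

End Separation.

(** * Matrix tests *)

Section States.
Variables (R : realType) (T : cstarAlgType R).

Lemma mxstateD k (f : mxstate T k) (X Y : 'M[T]_k) : f (X + Y) = f X + f Y.
Proof.
have <- : mxscale 1 X = X by apply/matrixP => i j; rewrite !mxE scale1r.
rewrite mxstate_linear mul1r; congr (f _ + _).
by apply/matrixP => i j; rewrite !mxE scale1r.
Qed.

Lemma mxstate0 k (f : mxstate T k) : f 0 = 0.
Proof. by apply: (addrI (f 0)); rewrite -mxstateD !addr0. Qed.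

Lemma mxstateZ k (f : mxstate T k) (c : R[i]) (X : 'M[T]_k) :
  f (mxscale c X) = c * f X.
Proof. by rewrite -[mxscale c X]addr0 mxstate_linear mxstate0 addr0. Qed.

(* The rows of a rectangular [Z], padded to square matrices. *)
Lemma mxstate_starM_ge0 p k (f : mxstate T k.+1) (Z : 'M[T]_(p, k.+1)) :
  0 <= f (mxstar Z *m Z).
Proof.
pose W r : 'M[T]_k.+1 := \matrix_(i, j) if i == 0 then Z r j else 0.
have -> : mxstar Z *m Z = \sum_r mxstar (W r) *m W r.
  apply/matrixP => i j; rewrite mxE summxE; apply: eq_bigr => r _.
  rewrite !mxE (bigD1 0) //= big1 => [|q q0]; first by rewrite !mxE eqxx addr0.
  by rewrite !mxE (negPf q0) mulr0.
rewrite (big_morph f (mxstateD f) (mxstate0 f)); apply: sumr_ge0 => r _.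
by apply: mxstate_ge0; exists (W r).
Qed.

Lemma mxstate1_exists : exists f : mxstate T 1, True.
Proof.
have [f [flin fpos f1]] := state_exists T.
have lin (c : R[i]) (X Y : 'M[T]_1) :
  f ((mxscale c X + Y) 0 0) = c * f (X 0 0) + f (Y 0 0) by rewrite !mxE flin.
have ge0 (X : 'M[T]_1) : mxpositive X -> 0 <= f (X 0 0).
  by move=> [Y ->]; rewrite mxE big_ord1 !mxE fpos.
have one : f ((1%:M : 'M[T]_1) 0 0) = 1 by rewrite mxE.
by exists (MxState lin ge0 one).
Qed.

Section Mean.
Variables (k l : nat) (f : mxstate T k.+1) (g : mxstate T l.+1).

Let mean (X : 'M[T]_(k.+1 + l.+1)) : R[i] :=
  2^-1 * (f (ulsubmx X) + g (drsubmx X)).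

Let mean_linear (c : R[i]) (X Y : 'M[T]_(k.+1 + l.+1)) :
  mean (mxscale c X + Y) = c * mean X + mean Y.
Proof.
rewrite /mean.
have -> : ulsubmx (mxscale c X + Y) = mxscale c (ulsubmx X) + ulsubmx Y.
  by apply/matrixP => i j; rewrite !mxE.
have -> : drsubmx (mxscale c X + Y) = mxscale c (drsubmx X) + drsubmx Y.
  by apply/matrixP => i j; rewrite !mxE.
by rewrite !mxstate_linear; ring.
Qed.

Let mean_ge0 (X : 'M[T]_(k.+1 + l.+1)) : mxpositive X -> 0 <= mean X.
Proof.
move=> [Y ->].
(* The factors are rectangular blocks of columns of [Y], whence the need for [mxstate_starM_ge0]. *)
have ul : ulsubmx (mxstar Y *m Y) = mxstar (lsubmx Y) *m lsubmx Y.
  apply/matrixP => i j; rewrite !mxE; apply: eq_bigr => q _.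
  by rewrite !mxE.
have dr : drsubmx (mxstar Y *m Y) = mxstar (rsubmx Y) *m rsubmx Y.
  apply/matrixP => i j; rewrite !mxE; apply: eq_bigr => q _.
  by rewrite !mxE.
by rewrite /mean ul dr mulr_ge0 ?invr_ge0 // addr_ge0 // mxstate_starM_ge0.
Qed.

Let mean1 : mean 1%:M = 1.
Proof.
rewrite /mean scalar_mx_block block_mxKul block_mxKdr !mxstate1.
by rewrite -[1 + 1]/(2%:R) mulVf // pnatr_eq0.
Qed.

Definition mxstate_mean : mxstate T (k.+1 + l.+1) :=
  MxState mean_linear mean_ge0 mean1.

Lemma mxstate_meanE (X : 'M[T]_(k.+1 + l.+1)) :
  mxstate_mean X = 2^-1 * (f (ulsubmx X) + g (drsubmx X)).
Proof. by []. Qed.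

End Mean.
End States.

Section Tests.
Variables (R : realType) (A T : cstarAlgType R) (S : opSystem A).
Implicit Types (K L : set (S -> T)) (Phi Psi : S -> T) (t : matrix_test T S).

Lemma CP_linear Phi : CP T S Phi -> linear Phi. Proof. by case. Qed.

Lemma linear_map0 Phi : linear Phi -> Phi 0 = 0.
Proof.
move=> lin; have := lin 1 0 0; rewrite !scale1r addr0 => e.
by apply: (addrI (Phi 0)); rewrite -e addr0.
Qed.

Lemma linear_mapZ Phi (c : R[i]) x : linear Phi -> Phi (c *: x) = c *: Phi x.
Proof. by move=> lin; have := lin c x 0; rewrite !addr0 linear_map0 // addr0. Qed.

Lemma test_evalD t Phi Psi :
  test_eval t (fun x => Phi x + Psi x) = test_eval t Phi + test_eval t Psi.
Proof.
by rewrite /test_eval -mxstateD; congr (mt_state t _); apply/matrixP => i j; rewrite !mxE.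
Qed.

Lemma test_evalZ t (c : R[i]) Phi :
  test_eval t (fun x => c *: Phi x) = c * test_eval t Phi.
Proof.
by rewrite /test_eval -mxstateZ; congr (mt_state t _); apply/matrixP => i j; rewrite !mxE.
Qed.

Lemma test_evalB t (Phi Psi : Espace T S) :
  test_eval t (E_val (Phi - Psi)) = test_eval t Phi - test_eval t Psi.
Proof.
rewrite -mulN1r -test_evalZ -test_evalD; congr (test_eval t _).
by apply/funext => x; rewrite scaleN1r.
Qed.

(** The empty combination of tests, and also the proof that a test exists at all, which rests on the
    existence of a state. *)
Lemma zero_test : exists t, forall Phi, linear Phi -> test_eval t Phi = 0.
Proof.
have [f _] := mxstate1_exists T.
exists (@MatrixTest R A T S 0 f 0) => Phi lin; rewrite /test_eval /=.
rewrite -[RHS](mxstate0 f); congr (f _); apply/matrixP => i j.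
by rewrite !mxE linear_map0.
Qed.

(** The scalar is moved into the matrix over [S], since a multiple of a state need not be a
    state. *)
Lemma scaled_test (c : R[i]) t :
  exists t', forall Phi, linear Phi -> test_eval t' Phi = c * test_eval t Phi.
Proof.
case: t => k f s; exists (MatrixTest f (map_mx (fun x => c *: x) s)) => Phi lin.
rewrite -test_evalZ /test_eval /=; congr (f _); apply/matrixP => i j.
by rewrite !mxE linear_mapZ.
Qed.

Lemma sum_test t u : exists t', forall Phi, linear Phi ->
  test_eval t' Phi = test_eval t Phi + test_eval u Phi.
Proof.
case: t => k f s; case: u => l g r.
(* Doubling both elements cancels the factor one half in the mean of the states. *)
pose two (q : nat) (X : 'M[S]_q) := map_mx (fun x => (2 : R[i]) *: x) X.
exists (@MatrixTest R A T S (k + l.+1) (mxstate_mean f g)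
  (block_mx (two _ s) 0 0 (two _ r) : 'M[S]_(k.+1 + l.+1))) => Phi lin.
rewrite /test_eval /=.
rewrite -[LHS]/(mxstate_mean f g
  (map_mx Phi (block_mx (two _ s) 0 0 (two _ r)))).
rewrite map_block_mx mxstate_meanE block_mxKul block_mxKdr.
have tw q (X : 'M[S]_q) : map_mx Phi (two q X) = mxscale 2 (map_mx Phi X).
  by apply/matrixP => i j; rewrite !mxE linear_mapZ.
by rewrite !tw !mxstateZ -mulrDr mulKf // pnatr_eq0.
Qed.

(** As functionals on linear maps, tests are closed under complex linear combinations, so a
    functional that separates finitely many test values is again one test. *)
Lemma combined_test n (c : 'I_n -> R[i]) (t : 'I_n -> matrix_test T S) :
  exists t', forall Phi, linear Phi ->
    test_eval t' Phi = \sum_i c i * test_eval (t i) Phi.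
Proof.
elim: n c t => [|n IH] c t.
  by have [t' h] := zero_test; exists t' => Phi /h ->; rewrite big_ord0.
have [u hu] := IH (fun i => c (lift ord0 i)) (fun i => t (lift ord0 i)).
have [v hv] := scaled_test (c ord0) (t ord0); have [w hw] := sum_test v u.
exists w => Phi lin.
by rewrite hw // hv // hu // big_ord_recl.
Qed.

Lemma E_linear (Phi : Espace T S) : linear Phi.
Proof.
case: Phi => Phi PhiE /=; have /asboolP[n [c [F [FCP ->]]]] := PhiE.
move=> a x y.
rewrite !fct_sumE scaler_sumr -big_split; apply: eq_bigr => i _ /=.
rewrite -[LHS]/(c i *: F i (a *: x + y)) (FCP i).1 scalerDr.
by rewrite -[RHS]/(a *: (c i *: F i x) + c i *: F i y) !scalerA mulrC.
Qed.

Lemma CP_E_valP Phi : CP T S Phi -> Phi \in @CP_span R A T S.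
Proof.
move=> PhiCP; apply/asboolP; exists 1%N, (fun=> 1), (fun=> Phi).
by split=> //; rewrite big_ord1 scale1r.
Qed.

Lemma Re_le_normc (z : R[i]) : `|complex.Re z| <= Normc.normc z.
Proof.
by case: z => a b /=; rewrite -sqrtr_sqr ler_wsqrtr // lerDl sqr_ge0.
Qed.

Lemma normc_le_ReIm (z : R[i]) :
  Normc.normc z <= `|complex.Re z| + `|complex.Im z|.
Proof.
case: z => a b /=; have ab : 0 <= `|a| + `|b| by rewrite addr_ge0.
rewrite -[leRHS]ger0_norm // -sqrtr_sqr ler_wsqrtr // sqrrD !real_normK ?num_real //.
by rewrite -addrA lerD2l lerDr mulrn_wge0 // mulr_ge0.
Qed.

Lemma ReB (z w : R[i]) : complex.Re (z - w) = complex.Re z - complex.Re w.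
Proof. by case: z; case: w. Qed.

(** * Closures compared through support functions *)

Lemma closure_test K (Phi : Espace T S) t (e : R) : 0 < e ->
  tau_closure (cconv K) Phi -> exists2 Psi, cconv K Psi &
    complex.Re (test_eval t Phi) - e < complex.Re (test_eval t Psi).
Proof.
move=> e0 /(_ (tau_ball (fun _ : 'I_1 => t) e Phi)) [].
  by exists 1%N, (fun=> t), e; split.
move=> Psi [KPsi /(_ ord0)]; rewrite /test_seminorm test_evalB => lt.
exists Psi => //.
have := le_lt_trans (Re_le_normc _) lt; rewrite ReB ltr_norml => /andP[+ _].
by lra.
Qed.

Lemma test_le_support K t Psi : cconv K Psi ->
  ((complex.Re (test_eval t Psi))%:E <= support_fun K t)%E.
Proof. by move=> KPsi; apply: ereal_sup_ubound; exists Psi. Qed.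

(** An element of [cconv K] lies in its own closure, hence is approximated on the single test [t] by
    elements of [cconv L]. *)
Lemma support_fun_mono K L : K `<=` CP T S ->
  tau_closure (cconv K) `<=` tau_closure (cconv L) ->
  forall t, (support_fun K t <= support_fun L t)%E.
Proof.
move=> KCP KL t; apply: ge_ereal_sup => _ [Psi KPsi <-].
apply/lee_addgt0Pr => e e0.
have PsiE := CP_E_valP (cconv_CP KCP KPsi).
have PsiK : tau_closure (cconv K) (ESpace PsiE) by exact: subset_closure.
have [Xi LXi lt] := closure_test t e0 (KL _ PsiK).
apply: (@le_trans _ _ ((complex.Re (test_eval t Xi))%:E + e%:E)%E).
  by rewrite -EFinD lee_fin -lerBlDr ltW.
by rewrite leeD2r // test_le_support.
Qed.

(** If [cconv L] were empty, its support function would be minus infinity at every test, while that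
    of [K] is bounded below by a real number. *)
Lemma cconv_neq0 K L : (forall t, (support_fun K t <= support_fun L t)%E) ->
  cconv K !=set0 -> cconv L !=set0.
Proof.
move=> KL [Psi KPsi]; have [t _] := zero_test.
apply/set0P/eqP => L0; have := le_trans (test_le_support t KPsi) (KL t).
by rewrite /support_fun L0 image_set0 ereal_sup0 leeNy_eq.
Qed.

(** Real and imaginary parts of the test values place the problem in a real space of dimension
    [2 n], where [convex_separation] gives coefficients and [combined_test] makes them one test. *)
Lemma separating_test L n (t : 'I_n -> matrix_test T S) (e : R)
    (Phi : Espace T S) : L `<=` CP T S -> cconv L !=set0 ->
  (forall Psi, cconv L Psi ->
    exists i, e <= Normc.normc (test_eval (t i) Psi - test_eval (t i) Phi)) ->
  exists u, forall Psi, cconv L Psi ->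
    complex.Re (test_eval u Psi) <= complex.Re (test_eval u Phi) - e.
Proof.
move=> LCP [Psi0 LPsi0] far.
(* Centring at [Phi] turns the distance from [Phi] into a distance from the origin. *)
pose z i Psi := test_eval (t i) Psi - test_eval (t i) Phi.
pose vec Psi : 'rV[R]_(n + n) :=
  row_mx (\row_i complex.Re (z i Psi)) (\row_i complex.Im (z i Psi)).
have vecl Psi i : vec Psi 0 (lshift n i) = complex.Re (z i Psi).
  by rewrite /vec row_mxEl mxE.
have vecr Psi i : vec Psi 0 (rshift n i) = complex.Im (z i Psi).
  by rewrite /vec row_mxEr mxE.
have [||_ [Psi LPsi <-]|c hc] := @convex_separation R (n + n) (vec @` cconv L) e.
- by exists (vec Psi0), Psi0.
- move=> _ _ r [Psi LPsi <-] [Xi LXi <-] r0 r1.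
  exists (fun x => sc T r * Psi x + sc T (1 - r) * Xi x).
    exact: cconv_convex.
  have zE i : z i (fun x => sc T r * Psi x + sc T (1 - r) * Xi x) =
      r%:C * z i Psi + (1 - r)%:C * z i Xi.
    rewrite /z test_evalD.
    have -> : (fun x => sc T r * Psi x) = (fun x => r%:C *: Psi x).
      by apply/funext => x; rewrite scE.
    have -> : (fun x => sc T (1 - r) * Xi x) = (fun x => (1 - r)%:C *: Xi x).
      by apply/funext => x; rewrite scE.
    by rewrite !test_evalZ rmorphB rmorph1; ring.
  apply/rowP => j; rewrite !mxE; case: (fintype.split j) => i; rewrite !mxE zE;
    by case: (z i Psi) => a b; case: (z i Xi) => a' b' /=; ring.
- have [i ei] := far _ LPsi; rewrite big_split_ord /= (bigD1 i) //=.
  rewrite [X in _ + X](bigD1 i) //= vecl vecr.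
  apply: le_trans ei _; apply: le_trans (normc_le_ReIm _) _.
  by rewrite addrACA lerDl addr_ge0 // sumr_ge0.
(* Conjugate coefficients make the real part of the complex sum equal the real linear form; the sign
   turns its lower bound into an upper bound for [cconv L]. *)
have [u hu] := combined_test
  (fun i => - (c (lshift n i) -i* c (rshift n i))) t.
exists u => Psi LPsi.
rewrite hu; last exact/CP_linear/(cconv_CP LCP).
rewrite hu; last exact: E_linear.
have := hc _ (imageP vec LPsi); rewrite big_split_ord /=.
have -> : \sum_i c (lshift n i) * vec Psi 0 (lshift n i) +
    \sum_i c (rshift n i) * vec Psi 0 (rshift n i) =
    complex.Re (\sum_i (c (lshift n i) -i* c (rshift n i)) * z i Psi).
  rewrite (big_morph (@complex.Re R) (id1 := 0) (op1 := +%R)) //; last first.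
    by case=> ? ? [].
  rewrite -big_split; apply: eq_bigr => i _ /=; rewrite vecl vecr.
  by case: (z i Psi) => a b /=; ring.
have -> : \sum_i (c (lshift n i) -i* c (rshift n i)) * z i Psi =
  \sum_i - (c (lshift n i) -i* c (rshift n i)) * test_eval (t i) Phi -
  \sum_i - (c (lshift n i) -i* c (rshift n i)) * test_eval (t i) Psi.
  by rewrite -sumrB; apply: eq_bigr => i _; rewrite /z; ring.
rewrite ReB; lra.
Qed.

Lemma tau_closure_mono K L : L `<=` CP T S ->
  (forall t, (support_fun K t <= support_fun L t)%E) ->
  tau_closure (cconv K) `<=` tau_closure (cconv L).
Proof.
move=> LCP KL Phi PhiK B [n [t [e [e0 eB]]]].
have [zt _] := zero_test; have [Psi0 KPsi0 _] := closure_test zt ltr01 PhiK.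
have L0 : cconv L !=set0 by apply: (cconv_neq0 KL); exists Psi0.
suff [Psi [LPsi near]] : exists Psi, cconv L Psi /\ forall i,
    Normc.normc (test_eval (t i) Psi - test_eval (t i) Phi) < e.
  exists (ESpace (CP_E_valP (cconv_CP LCP LPsi))); split=> //.
  by apply: eB => i; rewrite /test_seminorm test_evalB; exact: near.
apply: contrapT => no.
have [|u hu] := @separating_test L n t e Phi LCP L0.
  move=> Psi LPsi; apply: contrapT => no_i; apply: no; exists Psi; split=> // i.
  by rewrite ltNge; apply/negP => ei; apply: no_i; exists i.
(* The separation gap [e] is reused as the accuracy: [Xi] lies strictly above the level [Re - e]
   that bounds the support function of [L] at [u]. *)
have [Xi KXi lt] := closure_test u e0 PhiK.
have : ((complex.Re (test_eval u Xi))%:E <=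
    (complex.Re (test_eval u Phi) - e)%:E)%E.
  apply: le_trans (test_le_support u KXi) (le_trans (KL u) _).
  by apply: ge_ereal_sup => _ [Psi LPsi <-]; rewrite lee_fin hu.
by rewrite lee_fin leNgt lt.
Qed.

End Tests.

Theorem corollary4p4 (R : realType) (A T : cstarAlgType R) (S : opSystem A)
    (K L : set (S -> T)) (hK : K `<=` CP T S) (hL : L `<=` CP T S) :
  tau_closure (cconv K) `<=` tau_closure (cconv L) <->
  (forall t : matrix_test T S, (support_fun K t <= support_fun L t)%E).
Proof. by split; [exact: support_fun_mono | exact: tau_closure_mono]. Qed.
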